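(* Let $S\subset\mathbb{R}^n$ be a semialgebraic set and let $I\subset\mathbb{R}[x]=\mathbb{R}[x_1,\dots,x_n]$ be an ideal with prime decomposition $I=I_1\cap\cdots\cap I_k$. Then the following are equivalent: (1) $\mathcal{I}(S\cap\mathcal{V}(I))=I$; (2) for every $t$ with $1\le t\le k$, $\dim^{\mathrm{top}}(S\cap\mathcal{V}(I_t))=\dim I_t$.
   Context: A semialgebraic set in $\mathbb{R}^n$ is a finite union of sets of the form $\bigcap_{j}\{x: g_{j}(x)*_{j}0\}$ with $g_j\in\mathbb{R}[x]$ and each $*_j$ one of $>,\ge,=$. For an ideal $J\subset\mathbb{R}[x]$, $\mathcal{V}(J)=\{x\in\mathbb{R}^n:p(x)=0\ \forall p\in J\}$; for $A\subset\mathbb{R}^n$, $\mathcal{I}(A)=\{p\in\mathbb{R}[x]:p|_A=0\}$. ''Prime decomposition'' means an irredundant expression of $I$ as an intersection of prime ideals $I_1,\dots,I_k$ of $\mathbb{R}[x]$. For a prime ideal $J$, $\dim J$ is the transcendence degree over $\mathbb{R}$ of the fraction field of $\mathbb{R}[x]/J$ (the Krull dimension of $\mathbb{R}[x]/J$), with $\dim\mathbb{R}[x]=-1$. $\dim^{\mathrm{top}}A$ of a semialgebraic set $A$ is its topological dimension, i.e. the maximal dimension of a manifold contained in it, with $\dim^{\mathrm{top}}\emptyset=-1$. *)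

(* Defs.v *)
From mathcomp Require Import all_boot all_algebra.
From mathcomp Require Import reals.
From mathcomp Require Import mpoly.
From Stdlib Require List.

Set Implicit Arguments.
Unset Strict Implicit.
Unset Printing Implicit Defensive.

Import GRing.Theory Num.Theory.
Local Open Scope ring_scope.

Section Defs.
Variable R : realType.

Definition is_ideal n (I : {mpoly R[n]} -> Prop) : Prop :=
  [/\ I 0, (forall p q, I p -> I q -> I (p + q)) &
      (forall p q, I q -> I (p * q))].

Definition is_prime_ideal n (P : {mpoly R[n]} -> Prop) : Prop :=
  [/\ is_ideal P, ~ P 1 & (forall p q, P (p * q) -> P p \/ P q)].

Definition prime_decomposition n (I : {mpoly R[n]} -> Prop) (k : nat)
  (Is : 'I_k -> {mpoly R[n]} -> Prop) : Prop :=
  [/\ (forall t, is_prime_ideal (Is t)),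
      (forall p, I p <-> (forall t, Is t p)) &
      (* irredundant: no component can be dropped *)
      (forall j, exists p, (forall t, t != j -> Is t p) /\ ~ Is j p)].

Definition zero_set n (J : {mpoly R[n]} -> Prop) : ('I_n -> R) -> Prop :=
  fun x => forall p, J p -> p.@[x] = 0.

Definition vanishing_ideal n (A : ('I_n -> R) -> Prop) : {mpoly R[n]} -> Prop :=
  fun p => forall x, A x -> p.@[x] = 0.

Inductive sign_cond := SGt | SGe | SEq.

Definition sat_cond n (c : {mpoly R[n]} * sign_cond) (x : 'I_n -> R) : Prop :=
  match c.2 with
  | SGt => 0 < c.1.@[x]
  | SGe => 0 <= c.1.@[x]
  | SEq => c.1.@[x] = 0
  end.

Definition semialgebraic n (S : ('I_n -> R) -> Prop) : Prop :=
  exists L : seq (seq ({mpoly R[n]} * sign_cond)),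
    forall x, S x <-> exists2 l, List.In l L &
                        forall c, List.In c l -> sat_cond c x.

Definition near_pt n (e : R) (x y : 'I_n -> R) : Prop :=
  forall i, `|y i - x i| < e.

Definition open_set n (U : ('I_n -> R) -> Prop) : Prop :=
  forall x, U x -> exists2 e : R, 0 < e & forall y, near_pt e x y -> U y.

Definition continuous_on n m (D : ('I_n -> R) -> Prop)
  (f : ('I_n -> R) -> ('I_m -> R)) : Prop :=
  forall x, D x -> forall e : R, 0 < e -> exists2 d : R, 0 < d &
    forall y, D y -> near_pt d x y -> near_pt e (f x) (f y).

Definition is_manifold n (d : nat) (M : ('I_n -> R) -> Prop) : Prop :=
  (exists x, M x) /\
  forall x, M x ->
    exists W : ('I_n -> R) -> Prop, exists U : ('I_d -> R) -> Prop,
    exists phi : ('I_n -> R) -> ('I_d -> R), exists psi : ('I_d -> R) -> ('I_n -> R),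
      [/\ open_set W, W x & open_set U] /\
      [/\ (forall y, M y -> W y -> U (phi y)),
          (forall u, U u -> M (psi u) /\ W (psi u)),
          (forall y, M y -> W y -> psi (phi y) = y) &
          (forall u, U u -> phi (psi u) = u)] /\
      (continuous_on (fun y => M y /\ W y) phi /\ continuous_on U psi).

Definition contains_manifold n (A : ('I_n -> R) -> Prop) (d : nat) : Prop :=
  exists M, (forall x, M x -> A x) /\ is_manifold d M.

End Defs.

(* d (in int, allowing -1) is the supremum of {e : nat | P e}, with the
   convention sup(empty) = -1. *)
Definition nat_sup_is (P : nat -> Prop) (d : int) : Prop :=
  (forall e : nat, P e -> (e%:Z <= d)%R) /\
  (d = (-1)%R \/ exists2 e : nat, P e & d = e%:Z).

Definition dim_top_is (R : realType) n (A : ('I_n -> R) -> Prop) (d : int) : Prop :=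
  nat_sup_is (contains_manifold A) d.

Definition prime_chain (R : realType) n (J : {mpoly R[n]} -> Prop) (e : nat) : Prop :=
  exists P : nat -> {mpoly R[n]} -> Prop,
    [/\ (forall p, P 0%N p <-> J p),
        (forall i, (i <= e)%N -> is_prime_ideal (P i)) &
        (forall i, (i < e)%N ->
           (forall p, P i p -> P i.+1 p) /\ exists p, P i.+1 p /\ ~ P i p)].

(* Krull dimension of R[x]/J, i.e. the maximal length of a chain of primes
   of R[x] starting at J (for J prime this equals trdeg of Frac(R[x]/J));
   it is -1 when J is not prime, e.g. dim R[x] = -1. *)
Definition krull_dim_is (R : realType) n (J : {mpoly R[n]} -> Prop) (d : int) : Prop :=
  nat_sup_is (prime_chain J) d.

(* Main.v *)
From HB Require Import structures.
Require Import Defs.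
From mathcomp Require Import all_boot all_order all_algebra.
From mathcomp Require Import reals boolp.
From mathcomp Require classical_sets polyrcf.
From mathcomp Require Import mpoly.
From mathcomp Require Import zify ring lra.

Set Implicit Arguments.
Unset Strict Implicit.
Unset Printing Implicit Defensive.
Import Order.TTheory GRing.Theory Num.Theory.

(** Call a set T of variables independent modulo P when no nonzero polynomial
    in the variables of T lies in P.  If T is maximal, the other variables are
    algebraic over R[x_T] modulo the prime P; clearing denominators by some a
    in R[x_T] makes every element integral.  Hence any f outside P divides,
    modulo P, a nonzero element of R[x_T], so independent sets shrink along
    chains of primes; and if a does not vanish on x_i = c, then P + (x_i - c)
    meets R[x_(T \ i)] only in 0, so it extends to a prime in which T \ i is
    still independent.  So dim P is the largest size of an independent set.

    If a chart maps an open set of R^d injectively and continuously into R^n,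
    let T be maximal independent modulo the ideal vanishing on the image.  On a
    smaller box the projection to x_T has bounded fibres.  When |T| < d this is
    impossible: colour R^T with d colours whose monochromatic pieces are small;
    the Hex theorem yields a monochromatic chain crossing the cube, hence in
    the limit arbitrarily many points in one fibre.  So d <= |T|.

    Conversely, if only P vanishes on S and the zero set of P, one basic piece
    of S already has this property, and a generic point of it can be chosen
    where a triangular system of minimal polynomials for the variables outside
    T has simple roots.  Solving the system one variable at a time gives a
    continuous local section over R^T, which is a |T|-dimensional manifold.

    The theorem follows one component at a time: if the dimensions agree, a
    polynomial vanishing on S and the zero set of I_t but outside I_t would
    divide modulo I_t a nonzero polynomial in x_T that vanishes on the
    manifold. *)

(** * A discrete Poincare-Miranda theorem *)

Section DiscretePoincareMiranda.

Variables (K : comNzRingType) (d : nat).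
Hypothesis addxx : forall x : K, (x + x = 0)%R.
Local Open Scope ring_scope.

Notation grid := {ffun 'I_d -> nat}.

Definition gset (v : grid) (j : 'I_d) (c : nat) : grid :=
  [ffun i => if i == j then c else v i].

Definition gstep (j : 'I_d) (v : grid) : grid := gset v j (v j).+1.

Definition gdiff (j : 'I_d) (F : grid -> K) (v : grid) : K :=
  F (gstep j v) + F v.

(* The mod 2 cubical cochain df_1 u ... u df_k, written as the coboundary of
   f_1 (df_2 u ... u df_k), so that sums over boxes telescope. *)
Fixpoint cupd (fs : seq (grid -> K)) (J : {set 'I_d}) : grid -> K :=
  match fs with
  | [::] => fun=> 1
  | f :: fs' => fun v =>
      \sum_(j in J) gdiff j (fun w => f w * cupd fs' (J :\ j) w) v
  end.

Lemma gset_id v j c c' : gset (gset v j c) j c' = gset v j c'.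
Proof. by apply/ffunP=> k; rewrite !ffunE; case: eqP. Qed.

Lemma gsetC v i j c c' : i != j ->
  gset (gset v i c) j c' = gset (gset v j c') i c.
Proof.
move=> ij; apply/ffunP=> k; rewrite !ffunE.
by case: (eqVneq k j) => [->|//]; rewrite eq_sym (negPf ij).
Qed.

Lemma gstepC i j v : gstep i (gstep j v) = gstep j (gstep i v).
Proof.
have [->//|nij] := eqVneq i j.
by rewrite /gstep !ffunE (negPf nij) [j == i]eq_sym (negPf nij) gsetC // eq_sym.
Qed.

Lemma sum_sym_pairs (J : {set 'I_d}) (a : 'I_d -> 'I_d -> K) :
  (forall i j, a i j = a j i) -> \sum_(j in J) \sum_(i in J :\ j) a i j = 0.
Proof.
move=> asym; rewrite pair_big_dep /=.
rewrite (bigID (fun p : 'I_d * 'I_d => (p.1 < p.2)%N)) /=.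
have swapK : involutive (fun p : 'I_d * 'I_d => (p.2, p.1)) by case.
rewrite (reindex_inj (inv_inj swapK)) /=.
set s1 := \sum_(i | _) _; set s2 := \sum_(i | _) _.
suff -> : s2 = s1 by exact: addxx.
apply: eq_big => [[i j]|[i j] _] /=; last exact: asym.
rewrite !inE; case: (i \in J); case: (j \in J); rewrite ?andbF ?andbT //=.
by rewrite -!val_eqE /=; case: ltngtP.
Qed.

Lemma gdiff_sum j I (r : seq I) (Q : pred I) (F : I -> grid -> K) v :
  gdiff j (fun w => \sum_(i <- r | Q i) F i w) v
    = \sum_(i <- r | Q i) gdiff j (F i) v.
Proof. by rewrite /gdiff big_split. Qed.

Lemma gdiffC i j F v : gdiff i (gdiff j F) v = gdiff j (gdiff i F) v.
Proof. by rewrite /gdiff gstepC addrACA. Qed.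

(** A coboundary has zero coboundary: differences in two directions commute, and in characteristic
    two the symmetric terms cancel in pairs. *)
Lemma cupd_closed fs (J : {set 'I_d}) v : \sum_(j in J) gdiff j (cupd fs (J :\ j)) v = 0.
Proof.
case: fs => [|f fs] /=.
  by rewrite big1 // => j _; rewrite /gdiff addxx.
under eq_bigr => j _ do rewrite gdiff_sum.
rewrite -[RHS](sum_sym_pairs J (a := fun i j =>
   gdiff j (gdiff i (fun w => f w * cupd fs (J :\ j :\ i) w)) v)) // => i j.
by rewrite gdiffC; congr gdiff; rewrite /gdiff !setDDl setUC.
Qed.

(** The Leibniz rule; its second term is [f v] times a coboundary that vanishes by [cupd_closed].
    What remains is the front face times back face formula for cup products. *)
Lemma cupd_consE f fs (J : {set 'I_d}) v :
  cupd (f :: fs) J v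
    = \sum_(j in J) gdiff j f v * cupd fs (J :\ j) (gstep j v).
Proof.
have -> : \sum_(j in J) gdiff j f v * cupd fs (J :\ j) (gstep j v) =
  \sum_(j in J) gdiff j f v * cupd fs (J :\ j) (gstep j v) +
  f v * \sum_(j in J) gdiff j (cupd fs (J :\ j)) v.
  by rewrite cupd_closed mulr0 addr0.
rewrite mulr_sumr -big_split; apply: eq_bigr => j _ /=.
rewrite /gdiff !mulrDl !mulrDr -!addrA; congr (_ + _).
by rewrite !addrA addxx add0r.
Qed.

Definition incube (J : {set 'I_d}) (v w : grid) :=
  forall k, (v k <= w k <= v k + (k \in J))%N.

Lemma incube_refl J v : incube J v v.
Proof. by move=> k; rewrite leqnn leq_addr. Qed.

Lemma incube_step (J : {set 'I_d}) v j : j \in J -> incube J v (gstep j v).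
Proof.
move=> jJ k; rewrite ffunE; case: eqVneq => [->|_]; last by rewrite leqnn leq_addr.
by rewrite jJ addn1 leqnSn /= leqnn.
Qed.

Lemma incube_stepW (J : {set 'I_d}) v j w : j \in J ->
  incube (J :\ j) (gstep j v) w -> incube J v w.
Proof.
move=> jJ jw k; move: (jw k); rewrite !inE ffunE; case: (eqVneq k j) => [->|_] //=.
by rewrite jJ; lia.
Qed.

(** Expanded by [cupd_consE], every term contains a difference of each listed function along an edge
    of the cube. *)
Lemma cupd_const0 (J : {set 'I_d}) v (I : eqType) (s : seq I)
    (f : I -> grid -> K) i :
  i \in s -> (forall w, incube J v w -> f i w = f i v) ->
  cupd (map f s) J v = 0.
Proof.
elim: s J v => // i0 s IH J v; rewrite inE map_cons cupd_consE => iI fc.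
rewrite big1 // => j jJ; case/orP: iI => [/eqP<-|iI].
  by rewrite /gdiff fc ?addxx ?mul0r //; apply: incube_step.
rewrite IH ?mulr0 // => w jw.
by rewrite !fc //; [exact: incube_step | exact: incube_stepW jw].
Qed.

Variable m : nat.

Fixpoint sumbox (s : seq 'I_d) (F : grid -> K) (b : grid) : K :=
  if s is j :: s' then \sum_(c < m) sumbox s' F (gset b j c) else F b.

Lemma sumbox_sum s I (r : seq I) (Q : pred I) (F : I -> grid -> K) b :
  sumbox s (fun v => \sum_(i <- r | Q i) F i v) b
    = \sum_(i <- r | Q i) sumbox s (F i) b.
Proof.
elim: s b => [|j s IH] b //=.
by under eq_bigr => c _ do rewrite IH; rewrite exchange_big.
Qed.

Lemma sumbox_diff_notin s j F b : j \notin s ->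
  sumbox s (gdiff j F) b = gdiff j (sumbox s F) b.
Proof.
elim: s b => [|i s IH] b //=; rewrite inE negb_or => /andP[ji js].
rewrite /gdiff -big_split /=; apply: eq_bigr => c _; rewrite IH // /gdiff.
congr (sumbox s F _ + _).
by rewrite /gstep ffunE (negPf ji) gsetC // eq_sym.
Qed.

(** Telescoping: interior slices occur twice and cancel, leaving the two opposite faces. *)
Lemma sumbox_diff s j F b : uniq s -> j \in s ->
  sumbox s (gdiff j F) b = sumbox (rem j s) F (gset b j m) +
                           sumbox (rem j s) F (gset b j 0).
Proof.
elim: s b => [|i s IH] b //= /andP[iS us].
rewrite inE; case: (eqVneq i j) => [eij _ | nij].
  rewrite -eij; under eq_bigr => c _ do rewrite sumbox_diff_notin //.
  have H k : \sum_(c < k) gdiff i (sumbox s F) (gset b i c) =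
    sumbox s F (gset b i k) + sumbox s F (gset b i 0).
    elim: k => [|k IHk]; first by rewrite big_ord0 addxx.
    rewrite big_ord_recr /= IHk /gdiff /gstep ffunE eqxx gset_id.
    by rewrite addrC -addrA [X in _ + X]addrA addxx add0r.
  exact: H.
move=> /= js; rewrite -big_split /=.
by apply: eq_bigr => c _; rewrite IH // !(gsetC _ _ _ nij).
Qed.

Lemma sumbox_eq0 (s : seq 'I_d) (F : grid -> K) (b : grid) :
  (forall v : grid, (forall k, k \in s -> (v k < m)%N) ->
             (forall k, k \notin s -> v k = b k) -> F v = 0) ->
  uniq s -> sumbox s F b = 0.
Proof.
elim: s b => [|j s IH] b /= F0; first by move=> _; apply: F0.
move=> /andP[js us]; rewrite big1 // => c _; apply: IH => // v vm vb; apply: F0.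
  move=> k; rewrite inE => /orP[/eqP->|]; last exact: vm.
  by rewrite vb // ffunE eqxx.
move=> k; rewrite inE negb_or => /andP[kj ks].
by rewrite vb // ffunE (negPf kj).
Qed.

Lemma sumbox_eq (s : seq 'I_d) (F G : grid -> K) (b : grid) :
  (forall v : grid, (forall k, k \in s -> (v k < m)%N) ->
             (forall k, k \notin s -> v k = b k) -> F v = G v) ->
  uniq s -> sumbox s F b = sumbox s G b.
Proof.
elim: s b => [|j s IH] b /= FG; first by move=> _; apply: FG.
move=> /andP[js us]; apply: eq_bigr => c _; apply: IH => // v vm vb; apply: FG.
  move=> k; rewrite inE => /orP[/eqP->|]; last exact: vm.
  by rewrite vb // ffunE eqxx.
move=> k; rewrite inE negb_or => /andP[kj ks].
by rewrite vb // ffunE (negPf kj).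
Qed.

Variable f : 'I_d -> grid -> K.
Hypothesis f0 : forall i (v : grid), v i = 0%N -> f i v = 0.
Hypothesis fm : forall i (v : grid), v i = m -> f i v = 1.

Arguments sumbox : simpl never.

(** Telescoping, by induction on the dimension. Faces orthogonal to a direction j other than the
    first one, i, contribute 0 because [f j] is constant there. The face v i = 0 carries the factor
    0, and the face v i = m carries the factor 1 and the same sum in one dimension less. *)
Lemma sumbox_cupd s b : uniq s ->
  sumbox s (cupd (map f s) [set i in s]) b = 1.
Proof.
elim: s b => [|i s IH] b // uis; have /andP[iS us] : (i \notin s) && uniq s := uis.
rewrite sumbox_sum.
rewrite (bigD1 i) ?inE ?eqxx //=.
rewrite sumbox_diff ?inE ?eqxx //= eqxx.
rewrite [X in _ + X + _]sumbox_eq0 ?addr0 //; last first.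
  by move=> v _ vb; rewrite f0 ?mul0r // vb // ffunE eqxx.
rewrite big1 ?addr0 => [|j]; last first.
  rewrite inE andbC => /andP[ji jis].
  have js : j \in s by move: jis; rewrite !inE (negPf ji).
  rewrite sumbox_diff //.
  have faces c (jc : forall w : grid, w j = c -> f j w = f j (gset b j c)) :
      sumbox (rem j (i :: s))
        (fun w => f i w * cupd [seq f k | k <- s] ([set k in i :: s] :\ j) w)
        (gset b j c) = 0.
    apply: sumbox_eq0; last exact: rem_uniq.
    move=> v _ vb; rewrite (@cupd_const0 _ _ _ _ _ j) ?mulr0 // => w vw.
    have vj : v j = c by rewrite vb ?mem_rem_uniq ?inE ?eqxx // ffunE eqxx.
    rewrite !(jc _) // -vj; apply/eqP; rewrite eqn_leq andbC.
    by have := vw j; rewrite !inE eqxx addn0.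
  rewrite !faces ?addr0 // => w wj; [rewrite !f0 // | rewrite !fm //]; by rewrite ffunE eqxx.
rewrite -[RHS](IH (gset b i m)) //; apply: sumbox_eq => // v _ vb.
rewrite fm ?mul1r; last by rewrite vb // ffunE eqxx.
congr (cupd _ _ _); apply/setP=> k; rewrite !inE.
by case: (eqVneq k i) => // ->; rewrite (negPf iS).
Qed.

(** The cells sum to 1, so some cell is nonzero; by [cupd_const0] no [f i] is constant on it. *)
Lemma discrete_poincare_miranda :
  exists2 v : grid, (forall k, v k < m)%N &
    forall i, exists2 w, incube [set: 'I_d] v w & f i w != f i v.
Proof.
apply: contrapT => no.
have /eqP := sumbox_cupd [ffun=> 0%N] (enum_uniq 'I_d).
rewrite sumbox_eq0 ?enum_uniq // ?[_ == 1]eq_sym ?oner_eq0 // => v vm _.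
apply: contrapT => nz; apply: no; exists v.
  by move=> k; apply: vm; rewrite mem_enum.
move=> i; apply: contrapT => fc; apply: nz.
apply: (@cupd_const0 _ _ _ _ _ i) => [|w vw]; first by rewrite mem_enum.
apply: contrapT => /eqP ne; apply: fc; exists w => //.
by move=> k; have := vw k; rewrite !inE mem_enum.
Qed.

End DiscretePoincareMiranda.

(** * The Hex theorem *)

Section Hex.

Variable d : nat.
Notation grid := {ffun 'I_d -> nat}.

Definition gnear (r : nat) (u w : grid) :=
  forall k, (u k <= w k + r) /\ (w k <= u k + r).

(** The step size 2 adds the width 1 of a thickened chain to the width 1 of a cube. *)
Inductive reach (C : grid -> Prop) (u0 : grid) : grid -> Prop :=
| reach_refl : C u0 -> reach C u0 u0
| reach_step u w : reach C u0 u -> C w -> gnear 2 u w -> reach C u0 w.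

Lemma reach_in C u0 u : reach C u0 u -> C u.
Proof. by case. Qed.

(** If no colour crosses in its own direction, the thickened chains starting near the faces v i = 0
    define functions to which [discrete_poincare_miranda] applies. The lower corner of the cell
    obtained has some colour i, yet [f i] is constant on that cell. *)
Lemma hex m (C : 'I_d -> grid -> Prop) :
  0 < m ->
  (forall i v, C i v -> forall k, v k <= m) ->
  (forall v : grid, (forall k, v k <= m) -> exists i, C i v) ->
  exists i, exists u0 u : grid,
    [/\ u0 i <= 1, reach (C i) u0 u & m <= (u i).+1].
Proof.
move=> m0 Cm Ccov; apply: contrapT => no.
pose left i u := exists2 u0 : grid, u0 i <= 1 & reach (C i) u0 u.
have leftN i u : left i u -> (u i).+1 < m.
  move=> [u0 u0i r]; rewrite ltnNge; apply/negP=> mu; apply: no.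
  by exists i, u0, u.
(* Thickening the left-connected i-coloured vertices makes f i constant on
   every cube that has a vertex of colour i. *)
pose A i (v : grid) := v i = 0 \/ exists2 u, left i u & gnear 1 u v.
pose f i v : 'F_2 := if asbool (A i v) then 0%R else 1%R.
have [x|i v|i v vm|v vm nc] := @discrete_poincare_miranda _ d _ m f.
- by rewrite -mulr2n -(mulr_natr x 2) (_ : 2%:R = 0)%R ?mulr0 //; apply/eqP.
- by move=> vi; rewrite /f; case: asboolP => // -[]; left.
- rewrite /f; case: asboolP => // -[v0|[u /leftN um /(_ i)[_]]]; lia.
have [|i Civ] := Ccov v; first by move=> k; apply/ltnW/vm.
have [w vw /eqP[]] := nc i.
have near1 w' : incube [set: 'I_d] v w' -> gnear 1 v w'.
  by move=> vw' k; have := vw' k; rewrite inE; lia.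
(* If a chain contains the corner, its thickening contains the cell. Otherwise the thickening misses
   the cell, since a chain coming that close would extend to the corner. *)
have [l|nl] := pselect (left i v).
  rewrite /f !(asboolT _) //; right; exists v => //; apply: near1 => //.
  exact: incube_refl.
have fA w' : incube [set: 'I_d] v w' -> f i w' = 1%R.
  move=> vw'; rewrite /f asboolF // => -[w0|[u [u0 u0i r] uw]]; apply: nl.
    exists v; last exact: reach_refl.
    by have := vw' i; lia.
  exists u0 => //; apply: reach_step r Civ _ => k.
  by have := uw k; have := near1 _ vw' k; lia.
by rewrite !fA //; exact: incube_refl.
Qed.

(** A discrete intermediate value property: one step changes a coordinate by at most 2. *)
Lemma reach_level (C : grid -> Prop) (u0 u : grid) (i : 'I_d) l : reach C u0 u ->
  u0 i <= 1 -> l <= u i ->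
  exists2 w : grid, reach C u0 w & l <= w i <= l + 2.
Proof.
move=> r u0i; elim: r => [Cu0 lu|{}u w r IH Cw uw lw].
  by exists u0; [exact: reach_refl | lia].
have [/IH//|ul] := leqP l (u i).
exists w; first exact: reach_step r Cw uw.
by have := uw i; lia.
Qed.

End Hex.

Local Open Scope ring_scope.

(** * Large fibres of dimension-lowering maps *)

(** Deleting the residue class of i cuts the integers into runs of d - 1 consecutive ones, and a
    step of length at most 1 cannot change the run. *)
Lemma same_quotient (a b : int) (d i : nat) : (i < d)%N -> `|a - b| <= 1 ->
  (a %% d)%Z != i -> (b %% d)%Z != i -> ((a - i%:Z) %/ d)%Z = ((b - i%:Z) %/ d)%Z.
Proof.
move=> id ab am bm.
have d0 : (d%:Z != 0) by lia.
have dp : (0 < d%:Z) by lia.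
have rem c : (c %% d)%Z != i -> 0 < ((c - i%:Z) %% d)%Z < d%:Z.
  move=> cm; rewrite ltz_pmod // andbT lt_neqAle modz_ge0 // andbT.
  apply: contra cm => /eqP r0; have := divz_eq (c - i%:Z) d; rewrite -r0 addr0 => cE.
  by rewrite -(subrK i%:Z c) cE modzMDl modz_small //; lia.
have ra := rem _ am; have rb := rem _ bm.
have := divz_eq (a - i%:Z) d; have := divz_eq (b - i%:Z) d.
move: ((a - i%:Z) %% d)%Z ((a - i%:Z) %/ d)%Z ((b - i%:Z) %% d)%Z
  ((b - i%:Z) %/ d)%Z ra rb => r q r' q' ra rb bE aE.
have [qq|qq|//] := ltgtP q q'; exfalso.
  have : (q + 1) * d <= q' * d by rewrite ler_pM2r // lezD1.
  by rewrite mulrDl mul1r; lia.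
have : (q' + 1) * d <= q * d by rewrite ler_pM2r // lezD1.
by rewrite mulrDl mul1r; lia.
Qed.

Section FiniteFibres.

Variable R : realType.

Lemma ex_invSn_lt (e : R) : 0 < e -> exists k : nat, (k.+1%:R)^-1 < e.
Proof.
move=> e0; exists (Num.bound e^-1).
rewrite invf_plt ?posrE //; apply: lt_trans (archi_boundP _) _; first by rewrite invr_ge0 ltW.
by rewrite ltr_nat.
Qed.

Lemma ler_dist_nat (a b c : nat) : (a <= b + c)%N -> (b <= a + c)%N ->
  `|a%:R - b%:R| <= c%:R :> R.
Proof. by move=> ab ba; rewrite ler_distl lerBlDr -!natrD !ler_nat ba ab. Qed.

Lemma invSn_gt0 (k : nat) : 0 < (k.+1%:R)^-1 :> R.
Proof. by rewrite invr_gt0 ltr0Sn. Qed.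

Lemma le_invSn (k l : nat) : (k <= l)%N -> (l.+1%:R)^-1 <= (k.+1%:R)^-1 :> R.
Proof. by move=> kl; rewrite lef_pV2 ?posrE ?ltr0Sn // ler_nat. Qed.

Lemma cluster_point (x : nat -> R) : (forall s, 0 <= x s <= 1) ->
  exists2 y, 0 <= y <= 1 &
    forall e, 0 < e -> forall k, exists2 s, (k <= s)%N & `|x s - y| < e.
Proof.
(* The cluster point is the limit superior: the supremum of the levels reached arbitrarily late. *)
move=> x01; pose E : classical_sets.set R :=
  fun t => forall k, exists2 s, (k <= s)%N & t <= x s.
have E0 : E 0 by move=> k; exists k => //; case/andP: (x01 k).
have E1 t : E t -> t <= 1.
  by move=> /(_ 0%N)[s _ /le_trans->//]; case/andP: (x01 s).
have supE : classical_sets.has_sup E by split; [exists 0 | exists 1].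
exists (sup E).
  apply/andP; split; first exact: (ub_le_sup supE.2 E0).
  by apply: ge_sup => [|t /E1]; first by exists 0.
move=> e e0 k.
have [t Et st] := sup_adherent e0 supE.
have [l lP] : exists l, forall s, (l <= s)%N -> x s < sup E + e.
  apply: contrapT => no; have /(ub_le_sup supE.2) : E (sup E + e).
    move=> l; apply: contrapT => nl; apply: no; exists l => s ls.
    by rewrite ltNge; apply/negP => xs; apply: nl; exists s.
  by rewrite leNgt ltrDl e0.
have [s ms ts] := Et (maxn k l); exists s; first by lia.
rewrite ltr_distl; apply/andP; split; last by apply: lP; lia.
exact: lt_le_trans ts.
Qed.

Lemma bolzano_weierstrass (I : finType) (x : nat -> I -> R) :
  (forall s i, 0 <= x s i <= 1) ->
  exists2 y, (forall i, 0 <= y i <= 1) &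
    forall e, 0 < e -> forall k, exists2 s, (k <= s)%N & forall i, `|x s i - y i| < e.
Proof.
move=> x01.
have [phi [phik [y y01 xy]]] : exists phi : nat -> nat, (forall k, (k <= phi k)%N) /\
    exists2 y, (forall i, 0 <= y i <= 1) &
      forall k i, i \in enum I -> `|x (phi k) i - y i| < (k.+1%:R)^-1.
  elim: (enum I) => [|j r [phi [phik [y y01 xy]]]].
    by exists id; split=> //; exists (fun=> 0) => // i; rewrite lexx ler01.
  have [z z01 xz] := @cluster_point (fun s => x (phi s) j) (fun s => x01 _ _).
  have /choice[psi psiP] : forall k, exists s, (k <= s)%N /\
      `|x (phi s) j - z| < (k.+1%:R)^-1.
    by move=> k; have [s ks xs] := xz _ (invSn_gt0 k) k; exists s.
  exists (phi \o psi); split.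
    by move=> k /=; apply: leq_trans (phik _); case: (psiP k).
  exists (fun i => if i == j then z else y i).
    by move=> i; case: ifP => // _; apply: y01.
  move=> k i; rewrite inE /=; case: eqVneq => [-> _|_ /= ir].
    by case: (psiP k).
  apply: lt_le_trans (xy _ _ ir) _; apply: le_invSn.
  by case: (psiP k).
exists y => // e e0 k; have [l le] := ex_invSn_lt e0.
exists (phi (maxn k l)); first by apply: leq_trans (phik _); exact: leq_maxl.
move=> i; apply: lt_trans le; apply: lt_le_trans (xy _ _ _) _; first by rewrite mem_enum.
exact/le_invSn/leq_maxr.
Qed.

Definition unit_cube d (u : 'I_d -> R) : Prop := forall k, 0 <= u k <= 1.

Variables (d n : nat) (g : ('I_d -> R) -> ('I_n -> R)).
Hypothesis gcont : continuous_on (@unit_cube d) g.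

(** Pairs violating uniform continuity would cluster at a point of the cube where continuity
    fails. *)
Lemma unit_cube_unif_cont (e : R) : 0 < e -> exists2 r : R, 0 < r &
  forall u v, unit_cube u -> unit_cube v -> near_pt r u v -> near_pt e (g u) (g v).
Proof.
move=> e0; apply: contrapT => no.
have /choice[uv uvP] : forall s : nat, exists uv : ('I_d -> R) * ('I_d -> R),
    [/\ unit_cube uv.1, unit_cube uv.2, near_pt (s.+1%:R)^-1 uv.1 uv.2 &
        ~ near_pt e (g uv.1) (g uv.2)].
  move=> s; apply: contrapT => nos; apply: no; exists (s.+1%:R)^-1; first exact: invSn_gt0.
  by move=> u v cu cv uv; apply: contrapT => ng; apply: nos; exists (u, v).
have [|y y01 yP] := @bolzano_weierstrass _ (fun s => (uv s).1).
  by move=> s i; case: (uvP s) => + _ _ _; apply.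
have e20 : 0 < e / 2 by rewrite divr_gt0.
have [r r0 rP] := gcont y01 e20.
have [l lr] := ex_invSn_lt (divr_gt0 r0 (ltr0n _ 2)).
have [s ls us] := yP _ (divr_gt0 r0 (ltr0n _ 2)) l.
have [cu cv nuv] := uvP s; apply.
have gu : near_pt (e / 2) (g y) (g (uv s).1).
  by apply: rP => // k; apply: lt_trans (us k) _; lra.
have gv : near_pt (e / 2) (g y) (g (uv s).2).
  apply: rP => // k; have := nuv k; have := us k; have := le_invSn ls.
  move: lr; rewrite !ltr_norml; move: (l.+1%:R^-1) (s.+1%:R^-1) => a b; lra.
move=> k; have := gu k; have := gv k; rewrite !ltr_norml; lra.
Qed.



Variable T : {set 'I_n}.
Hypothesis Td : (#|T| < d)%N.

(** Along a chain given by [hex] the coordinates of [g] in T stay nearly constant, while the i-th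
    coordinate of the point crosses the cube. Vertices picked at N equally spaced levels are the
    required points. *)
Lemma approx_fibre (N : nat) (e : R) : (0 < N)%N -> 0 < e ->
  exists i, exists2 p : 'I_N -> ('I_d -> R),
    (forall j, unit_cube (p j) /\ p j i = j%:R / N%:R) &
    forall j j' t, t \in T -> `|g (p j) t - g (p j') t| < e.
Proof.
(* The error is (d + 1) h along the chain, plus h at each of the two points compared. *)
move=> N0 e0; pose h := e / (d.+3%:R).
have h0 : 0 < h by rewrite divr_gt0 // ltr0Sn.
have [r r0 rP] := unit_cube_unif_cont h0.
have [M0 M0r] := ex_invSn_lt (divr_gt0 r0 (ltr0n _ 2)).
(* The levels j / N lie on the grid of mesh 1 / m, and [M] makes two grid steps shorter than [r]. *)
pose M := M0.+1; pose m := (N * M)%N.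
have m0 : (0 < m)%N by rewrite muln_gt0 N0.
have mR : 0 < m%:R :> R by rewrite ltr0n.
have m2r : 2 / m%:R < r.
  have -> : r = 2 * (r / 2) by field.
  rewrite ltr_pM2l //; apply: le_lt_trans M0r.
  by rewrite lef_pV2 ?posrE ?ltr0Sn // ler_nat leq_pmull.
pose pt (v : {ffun 'I_d -> nat}) k : R := (v k)%:R / m%:R.
have pt_cube (v : {ffun 'I_d -> nat}) : (forall k, (v k <= m)%N) -> unit_cube (pt v).
  move=> vm k; rewrite /pt divr_ge0 ?ler0n //=.
  by rewrite ler_pdivrMr // mul1r ler_nat.
(* Colour i at v means that no a v t is i mod d; along a chain of colour i
   every a _ t then stays in one block of d - 1 consecutive integers. *)
pose a v t : int := Num.floor (g (pt v) t / h).
pose C (i : 'I_d) (v : {ffun 'I_d -> nat}) := (forall k, (v k <= m)%N) /\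
  forall t, t \in T -> (a v t %% d)%Z != i.
have d0 : (0 < d)%N by exact: leq_ltn_trans Td.
have [||i [u0 [u [u0i ru mu]]]] := @hex d m C m0.
- by move=> i v [].
- move=> v vm.
  have rd (z : int) : (`|(z %% d)%Z| < d)%N.
    have := ltz_pmod z (_ : 0 < d%:Z); have := modz_ge0 z (_ : d%:Z != 0).
    by lia.
  (* The residues of the [a v t] number at most #|T| < d, so some class is free. *)
  pose f t : 'I_d := Ordinal (rd (a v t)).
  have : (0 < #|~: (f @: T)|)%N.
    rewrite cardsCs setCK card_ord subn_gt0.
    exact: leq_ltn_trans (leq_imset_card _ _) Td.
  move=> /card_gt0P[i]; rewrite inE => iT; exists i; split=> // t tT.
  apply: contra iT => /eqP ati; apply/imsetP; exists t => //; apply: val_inj => /=.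
  by rewrite ati.
have a_near (u1 u2 : {ffun 'I_d -> nat}) t :
    (forall k, (u1 k <= m)%N) -> (forall k, (u2 k <= m)%N) ->
    gnear 2 u1 u2 -> `|a u1 t - a u2 t| <= 1.
  move=> m1 m2 u12.
  have : near_pt r (pt u1) (pt u2).
    move=> k; apply: le_lt_trans m2r; rewrite /pt -mulrBl normrM [X in _ * X]gtr0_norm ?invr_gt0 //.
    rewrite ler_pM2r ?invr_gt0 //; have [h1 h2] := u12 k.
    exact: ler_dist_nat.
  move=> /(rP _ _ (pt_cube _ m1) (pt_cube _ m2))/(_ t).
  rewrite -(ltr_pM2r (_ : 0 < h^-1)) ?invr_gt0 // divff ?gt_eqF //.
  rewrite -[X in `|_| * X]gtr0_norm ?invr_gt0 // -normrM mulrBl => gg.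
  have /andP[f1 f2] := floor_itv (g (pt u1) t / h).
  have /andP[f3 f4] := floor_itv (g (pt u2) t / h).
  rewrite -/(a u1 t) in f1 f2; rewrite -/(a u2 t) in f3 f4.
  have : (a u1 t - a u2 t)%:~R < 2%:~R :> R.
    rewrite intrD rmorphN /=; move: gg f1 f2 f3 f4; rewrite ltr_norml !intrD; lra.
  have : (a u2 t - a u1 t)%:~R < 2%:~R :> R.
    rewrite intrD rmorphN /=; move: gg f1 f2 f3 f4; rewrite ltr_norml !intrD; lra.
  rewrite !ltr_int; move: (a u1 t) (a u2 t) => b1 b2; clear; lia.
have quot w t : reach (C i) u0 w -> t \in T ->
    ((a w t - i%:Z) %/ d)%Z = ((a u0 t - i%:Z) %/ d)%Z.
  move=> rw tT; elim: rw => // u1 w1 r1 <- [w1m w1C] u1w1.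
  have [u1m u1C] := reach_in r1.
  apply: same_quotient => //; [|exact: w1C|exact: u1C].
  by rewrite distrC; exact: a_near.
have close w w' t : reach (C i) u0 w -> reach (C i) u0 w' -> t \in T ->
    `|g (pt w) t - g (pt w') t| < d.+1%:R * h.
  move=> rw rw' tT.
  have q1 := quot _ _ rw tT; have := quot _ _ rw' tT; rewrite -q1 => q2.
  have dz : d%:Z != 0 by rewrite eqz_nat -lt0n.
  have dp : 0 < d%:Z by rewrite ltz_nat.
  have := divz_eq (a w t - i%:Z) d; have := divz_eq (a w' t - i%:Z) d; rewrite q2.
  have := ltz_pmod (a w t - i%:Z) dp; have := modz_ge0 (a w t - i%:Z) dz.
  have := ltz_pmod (a w' t - i%:Z) dp; have := modz_ge0 (a w' t - i%:Z) dz.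
  move: (_ %% _)%Z (_ %% _)%Z (_ * _) => x y z x0 xd y0 yd E1 E2.
  have [A1 A2] : (a w t)%:~R <= (a w' t + d%:Z - 1)%:~R :> R /\
      (a w' t)%:~R <= (a w t + d%:Z - 1)%:~R :> R.
    rewrite !ler_int; move: (a w t) (a w' t) E1 E2 => b b' E1 E2.
    by clear -E1 E2 x0 xd y0 yd; lia.
  have /andP[f1 f2] := floor_itv (g (pt w) t / h).
  have /andP[f3 f4] := floor_itv (g (pt w') t / h).
  rewrite -/(a w t) in f1 f2; rewrite -/(a w' t) in f3 f4.
  rewrite -ltr_pdivrMr // -[X in `|_| * X]gtr0_norm ?invr_gt0 // -normrM mulrBl.
  rewrite -natr1; move: f1 f2 f3 f4 A1 A2; rewrite ltr_norml !intrD !rmorphN /= -?pmulrn; lra.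
have /choice[w wP] : forall j : 'I_N, exists w : {ffun 'I_d -> nat}, reach (C i) u0 w /\
    (j * M <= w i <= j * M + 2)%N.
  move=> j; have [|w rw wj] := reach_level (l := (j * M)%N) ru u0i; last by exists w.
  have : ((j.+1) * M <= N * M)%N by rewrite leq_mul2r ltn_ord orbT.
  by move: mu; rewrite /m mulSn /M; lia.
(* The i-th coordinate, off by at most two grid steps, is corrected to exactly j / N. *)
pose p (j : 'I_N) k : R := if k == i then j%:R / N%:R else pt (w j) k.
have pcube (j : 'I_N) : unit_cube (p j).
  have [wm _] := reach_in (wP j).1.
  move=> k; rewrite /p; case: eqP => _; last exact: pt_cube.
  rewrite divr_ge0 ?ler0n //= ler_pdivrMr ?ltr0n // mul1r ler_nat.
  exact/ltnW/ltn_ord.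
have gp j t : `|g (p j) t - g (pt (w j)) t| < h.
  have [wm _] := reach_in (wP j).1.
  apply: (rP _ _ (pt_cube _ wm) (pcube j)) => k; rewrite /p; case: eqP => [->|_].
    apply: le_lt_trans m2r; rewrite /pt.
    have -> : j%:R / N%:R = (j * M)%:R / m%:R :> R.
      by rewrite /m !natrM; field; rewrite !pnatr_eq0 -!lt0n N0.
    rewrite -mulrBl normrM [X in _ * X]gtr0_norm ?invr_gt0 //.
    rewrite ler_pM2r ?invr_gt0 // distrC; have [_ /andP[h1 h2]] := wP j.
    by rewrite -natrB // normr_nat ler_nat; lia.
  by rewrite subrr normr0.
exists i, p.
  by move=> j; split; [exact: pcube | rewrite /p eqxx].
move=> j j' t tT; have g1 := gp j t; have g2 := gp j' t.
have g3 := close _ _ _ (wP j).1 (wP j').1 tT.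
have eE : e = d.+1%:R * h + h + h.
  by rewrite /h -!natr1; field; rewrite !natr1 pnatr_eq0.
rewrite eE; move: g1 g2 g3; rewrite !ltr_norml; lra.
Qed.

(* This replaces invariance of domain: a chart composed with a projection
   with bounded fibres cannot lower the dimension. *)
Lemma large_fibre (N : nat) : exists2 p : 'I_N -> ('I_d -> R),
  injective p /\ (forall j, unit_cube (p j)) &
  forall j j' t, t \in T -> g (p j) t = g (p j') t.
Proof.
case: (posnP N) => [->|N0].
  by exists (fun _ _ => 0); [split=> -[] | case].
have /choice[ip ipP] : forall s : nat, exists ip : 'I_d * ('I_N -> ('I_d -> R)),
    (forall j, unit_cube (ip.2 j) /\ ip.2 j ip.1 = j%:R / N%:R) /\
    forall j j' t, t \in T -> `|g (ip.2 j) t - g (ip.2 j') t| < (s.+1%:R)^-1.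
  by move=> s; have [i [p p1 p2]] := approx_fibre N0 (invSn_gt0 s); exists (i, p).
have [|y y01 yP] := @bolzano_weierstrass _ (fun s (q : 'I_N * 'I_d) => (ip s).2 q.1 q.2).
  by move=> s q; case: (ipP s) => + _ => /(_ q.1)[+ _]; apply.
pose p (j : 'I_N) k := y (j, k).
(* The direction may vary with the precision. If every direction failed in the limit, a sufficiently
   close approximation would contradict its own direction. *)
have [i pi] : exists i, forall j : 'I_N, p j i = j%:R / N%:R.
  apply: contrapT => no.
  have /choice[je jeP] : forall i : 'I_d, exists je : 'I_N, p je i != je%:R / N%:R.
    move=> i; apply: contrapT => nj; apply: no; exists i => j.
    by apply/eqP; apply: contrapT => /negP ne; apply: nj; exists j.
  pose e := \big[Num.min/1]_(i < d) `|p (je i) i - (je i)%:R / N%:R|.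
  have e0 : 0 < e.
    rewrite /e; elim/big_ind: _ => // [x z x0 z0|i _]; first by rewrite lt_min x0.
    by rewrite normr_gt0 subr_eq0.
  have [s _ sP] := yP _ e0 0%N.
  have := sP (je (ip s).1, (ip s).1); rewrite /= distrC.
  case: (ipP s) => + _ => /(_ (je (ip s).1))[_ ->].
  by rewrite ltNge /e bigmin_le // ?mem_index_enum.
exists p.
  split; last by move=> j k; exact: y01.
  move=> j j' /(congr1 (fun q => q i)); rewrite !pi.
  have NR : (N%:R^-1 : R) != 0 by rewrite invr_eq0 pnatr_eq0 -lt0n.
  by move=> /(mulIf NR)/eqP; rewrite eqr_nat => /eqP/val_inj.
move=> j j' t tT; apply: contrapT => /eqP; rewrite -subr_eq0 -normr_gt0 => ne.
pose e := `|g (p j) t - g (p j') t| / 3.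
have e0 : 0 < e by rewrite divr_gt0.
have pc j1 : unit_cube (p j1) by move=> k; exact: y01.
have [r r0 rP] := gcont (pc j) e0; have [r' r'0 rP'] := gcont (pc j') e0.
have [l le] := ex_invSn_lt e0.
have mr0 : 0 < Num.min r r' by rewrite lt_min r0.
have [s ls sP] := yP _ mr0 l.
have [sc sg] := ipP s.
have g1 : `|g ((ip s).2 j) t - g (p j) t| < e.
  apply: rP => [|k]; first exact: (sc j).1.
  by have := sP (j, k); rewrite lt_min => /andP[].
have g2 : `|g ((ip s).2 j') t - g (p j') t| < e.
  apply: rP' => [|k]; first exact: (sc j').1.
  by have := sP (j', k); rewrite lt_min => /andP[].
have g3 : `|g ((ip s).2 j) t - g ((ip s).2 j') t| < e.
  apply: lt_trans (sg j j' t tT) _; apply: le_lt_trans le; exact: le_invSn.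
have : `|g (p j) t - g (p j') t| < e * 3.
  by move: g1 g2 g3; rewrite !ltr_norml; lra.
by rewrite /e divfK ?ltxx // pnatr_eq0.
Qed.

End FiniteFibres.

(** * Polynomials in a subset of the variables *)

Section QuotientRing.

Variables (A : comNzRingType) (P : A -> Prop).
Hypotheses (P0 : P 0) (PD : forall p q, P p -> P q -> P (p + q)).
Hypotheses (PM : forall p q, P q -> P (p * q)) (P1 : ~ P 1).

(** An actual quotient ring makes the closure of integral elements under sums and products
    available. *)
Lemma ex_quotient_ring :
  exists (B : comNzRingType) (pi : {rmorphism A -> B}), forall p, pi p = 0 <-> P p.
Proof.
pose Pb : A -> bool := fun p => `[< P p >].
have Pb_ideal : idealr_closed Pb.
  split=> [||a u v]; rewrite ?inE /in_mem /= /Pb; first exact/asboolP.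
    by apply/asboolP.
  by move=> /asboolP Pu /asboolP Pv; apply/asboolP; apply: PD => //; apply: PM.
pose I : idealr A := HB.pack Pb (isIdealr.Build A Pb Pb_ideal).
exists {ideal_quot I}, (\pi_({ideal_quot I}))%qT => p.
have -> : 0 = (\pi_({ideal_quot I}) 0)%qT :> {ideal_quot I} by rewrite rmorph0.
split=> [/eqP|Pp]; last apply/eqP; rewrite -Quotient.idealrBE subr0.
  by move=> /asboolP.
exact/asboolP.
Qed.

End QuotientRing.

Section Polynomials.

Variables (R : realType) (n : nat).
Local Notation A := {mpoly R[n]}.

Lemma mpoly_ring_ind (Q : A -> Prop) :
  (forall c, Q c%:MP) -> (forall i, Q 'X_i) ->
  (forall p q, Q p -> Q q -> Q (p + q)) -> (forall p q, Q p -> Q q -> Q (p * q)) ->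
  forall p, Q p.
Proof.
move=> QC QX QD QM p; rewrite [p]mpolyE.
have Q0 : Q 0 by rewrite -mpolyC0.
have Q1 : Q 1 by rewrite -mpolyC1.
apply: (big_ind Q Q0 QD) => m _; rewrite -mul_mpolyC; apply: (QM) => //.
rewrite mpolyXE_id; apply: (big_ind Q Q1 QM) => i _.
by elim: (m i) => [|k IH]; rewrite ?expr0 // exprS; apply: QM.
Qed.

Lemma eq_rmorph_mpoly (B : nzRingType) (f g : {rmorphism A -> B}) :
  (forall c, f c%:MP = g c%:MP) -> (forall i, f 'X_i = g 'X_i) -> f =1 g.
Proof.
move=> fgC fgX; elim/mpoly_ring_ind => // p q fp fq.
  by rewrite !rmorphD fp fq.
by rewrite !rmorphM fp fq.
Qed.

(* Sets the variables outside T to 0; its fixed points are the polynomials in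
   the variables of T. *)
Definition res (T : {set 'I_n}) : {rmorphism A -> A} :=
  mmap (@mpolyC n R) (fun i => if i \in T then 'X_i else 0).

Lemma resC T c : res T c%:MP = c%:MP.
Proof. exact: mmapC. Qed.

Lemma resX T i : res T 'X_i = if i \in T then 'X_i else 0.
Proof. by rewrite /res /= mmapX mmap1U. Qed.

Opaque res.

Lemma res_res T U p : res T (res U p) = res (T :&: U) p.
Proof.
apply: (@eq_rmorph_mpoly _ (res T \o res U) (res (T :&: U))) => [c|i] /=.
  by rewrite !resC.
by rewrite !resX inE; case: (i \in U); rewrite ?andbF ?andbT ?rmorph0 ?resX.
Qed.

Lemma res_id T p : res T (res T p) = res T p.
Proof. by rewrite res_res setIid. Qed.

Lemma res_sub (T U : {set 'I_n}) p : T \subset U -> res T p = p -> res U p = p.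
Proof. by move=> /setIidPr TU pT; rewrite -pT res_res TU. Qed.

Lemma resT p : res [set: 'I_n] p = p.
Proof.
apply: (@eq_rmorph_mpoly _ (res [set: 'I_n]) idfun) => [c|i] /=.
  by rewrite resC.
by rewrite resX inE.
Qed.

Lemma meval_res (T : {set 'I_n}) p (v w : 'I_n -> R) :
  res T p = p -> (forall i, i \in T -> v i = w i) -> p.@[v] = p.@[w].
Proof.
move=> <- vw; apply: (@eq_rmorph_mpoly _ (meval v \o res T) (meval w \o res T)) => [c|i] /=.
  by rewrite resC !mevalC.
by rewrite resX; case: ifP => iT; rewrite ?meval0 // !mevalXU vw.
Qed.

(** The polynomial read as univariate in ['X_j]. Coefficients stay in [A], so [res] acts on them and
    evaluation at ['X_j] recovers the polynomial. *)
Definition uni (j : 'I_n) : {rmorphism A -> {poly A}} :=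
  mmap (polyC \o @mpolyC n R) (fun i => if i == j then 'X else ('X_i)%:P).

Lemma uniC j c : uni j c%:MP = c%:MP%:P.
Proof. by rewrite /uni /= mmapC. Qed.

Lemma uniX j i : uni j 'X_i = if i == j then 'X else ('X_i)%:P.
Proof. by rewrite /uni /= mmapX mmap1U. Qed.

Opaque uni.

Lemma uniK j p : (uni j p).['X_j] = p.
Proof.
apply: (@eq_rmorph_mpoly _ (horner_eval 'X_j \o uni j) idfun) => [c|i] /=.
  by rewrite uniC /horner_eval hornerC.
by rewrite uniX /horner_eval; case: eqP => [->|_]; rewrite ?hornerX ?hornerC.
Qed.

Lemma uni_inj j : injective (uni j).
Proof. by move=> p q pq; rewrite -(uniK j p) pq uniK. Qed.

Lemma uni_res j (T : {set 'I_n}) p : j \notin T ->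
  uni j (res (j |: T) p) = map_poly (res T) (uni j p).
Proof.
move=> jT; apply: (@eq_rmorph_mpoly _ (uni j \o res (j |: T))
   (map_poly (res T) \o uni j)) => [c|i] /=.
  by rewrite resC !uniC map_polyC /= resC.
rewrite resX !uniX !inE; case: eqVneq => [->|ij] /=; first by rewrite uniX eqxx map_polyX.
rewrite map_polyC /= resX; case: ifP => _; last by rewrite rmorph0 polyC0.
by rewrite uniX (negPf ij).
Qed.

Lemma meval_horner (F : {poly A}) (p : A) (v : 'I_n -> R) :
  (F.[p]).@[v] = (map_poly (meval v) F).[p.@[v]].
Proof. by rewrite horner_map. Qed.

End Polynomials.

Arguments res {R n} T.
Arguments uni {R n} j.
Global Opaque res uni.

(** * Algebraic independence and chains of primes *)

Section Independence.

Variables (R : realType) (n : nat).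
Local Notation A := {mpoly R[n]}.
Implicit Types (P Q : A -> Prop) (T U : {set 'I_n}).

Lemma idealN P p : is_ideal P -> P p -> P (- p).
Proof. by case=> _ _ PM Pp; rewrite -mulN1r; apply: PM. Qed.

Lemma idealMr P p q : is_ideal P -> P p -> P (p * q).
Proof. by case=> _ _ PM Pp; rewrite mulrC; apply: PM. Qed.

Lemma idealB P p q : is_ideal P -> P p -> P q -> P (p - q).
Proof. by move=> Pi Pp Pq; case: (Pi) => _ PD _; apply: PD => //; apply: idealN. Qed.

Lemma ideal_sum P I (r : seq I) (S : pred I) (F : I -> A) :
  is_ideal P -> (forall i, S i -> P (F i)) -> P (\sum_(i <- r | S i) F i).
Proof. by case=> P0 PD _ PF; apply: (big_ind P). Qed.

Lemma idealX_sub P p q k : is_ideal P -> P (p - q) -> P (p ^+ k - q ^+ k).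
Proof. by move=> Pi Ppq; rewrite subrXX; apply: idealMr. Qed.

Lemma primeX P p k : is_prime_ideal P -> P (p ^+ k) -> P p.
Proof.
case=> Pi P1 PM; elim: k => [|k IH]; first by rewrite expr0 => /P1.
by rewrite exprS => /PM[].
Qed.

Definition indep P T := forall p : A, res T p = p -> P p -> p = 0.

Definition max_indep P T := indep P T /\ forall j, j \notin T -> ~ indep P (j |: T).

Lemma indep_subideal P Q T : (forall p, P p -> Q p) -> indep Q T -> indep P T.
Proof. by move=> PQ QT p pT /PQ; apply: QT. Qed.

Lemma indep0 P : is_ideal P -> ~ P 1 -> indep P set0.
Proof.
move=> [_ _ PM] P1 p p0 Pp; apply: contrapT => /eqP nz; apply: P1.
have [c pE] : exists c : R, p = c%:MP.
  rewrite -p0; elim/mpoly_ring_ind: p {p0 Pp nz} => [c|i|p q [c pE] [c' qE]|p q [c pE] [c' qE]].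
  - by exists c; rewrite resC.
  - by exists 0; rewrite resX inE mpolyC0.
  - by exists (c + c'); rewrite rmorphD /= pE qE mpolyCD.
  - by exists (c * c'); rewrite rmorphM /= pE qE mpolyCM.
have c0 : c != 0 by apply: contra nz; rewrite pE => /eqP->; rewrite mpolyC0.
have -> : 1 = c^-1%:MP * p by rewrite pE -mpolyCM mulVf // mpolyC1.
exact: PM.
Qed.

Lemma ex_max_indep P T : indep P T -> exists2 U : {set 'I_n}, T \subset U & max_indep P U.
Proof.
move: {2}(n - #|T|)%N (leqnn (n - #|T|)) => k; elim: k T => [|k IH] T Tk Ti.
  exists T => //; split=> // j jT _; have := max_card (mem (j |: T)).
  rewrite card_ord cardsU1 jT; lia.
have [[j jT ji]|no] := pselect (exists2 j, j \notin T & indep P (j |: T)).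
  have [|U TU Ui] := IH _ _ ji; first by rewrite cardsU1 jT; lia.
  by exists U => //; apply: subset_trans TU; exact: subsetUr.
by exists T => //; split=> // j jT ji; apply: no; exists j.
Qed.

(** A nonzero relation in the variables [j |: T] is read in ['X_j]; if it were constant there, it
    would be a relation in T. *)
Lemma dep_poly P T j : indep P T -> j \notin T -> ~ indep P (j |: T) ->
  exists F : {poly A}, [/\ map_poly (res T) F = F, (1 < size F)%N & P F.['X_j]].
Proof.
move=> Ti jT nji.
have [p [pT Pp p0]] : exists p, [/\ res (j |: T) p = p, P p & p <> 0].
  apply: contrapT => no; apply: nji => p pT Pp; apply: contrapT => p0.
  by apply: no; exists p.
have FT : map_poly (res T) (uni j p) = uni j p by rewrite -(uni_res p jT) pT.
exists (uni j p); split; [exact: FT | | by rewrite uniK].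
rewrite ltnNge; apply/negP => /size1_polyC E; apply: p0.
have pE : p = (uni j p)`_0 by rewrite -[LHS](uniK j) {1}E hornerC.
have cT : res T (uni j p)`_0 = (uni j p)`_0 by rewrite -coef_map FT.
by apply: Ti Pp; rewrite -pE in cT.
Qed.

Section Integrality.

Variables (P : A -> Prop) (T : {set 'I_n}).
Hypotheses (Pp : is_prime_ideal P) (Tmax : max_indep P T).

(** Multiplication by a leading coefficient makes each ['X_j] integral over R[x_T] modulo P. The
    product of these coefficients serves all variables, and its powers serve all polynomials. *)
Lemma integral_mod : exists a, [/\ res T a = a, a != 0 &
  forall g, exists N, exists chi : {poly A},
    [/\ chi \is monic, map_poly (res T) chi = chi & P chi.[a ^+ N * g]]].
Proof.
have [[P0 PD PM] P1 _] := Pp.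
have [B [pi piP]] := ex_quotient_ring P0 PD PM P1.
pose phi : {rmorphism A -> B} := pi \o res T.
pose int z := integralOver phi (pi z).
have map_phi (F : {poly A}) z : (map_poly phi F).[pi z] = pi (map_poly (res T) F).[z].
  by rewrite map_poly_comp horner_map.
have intT z : res T z = z -> int z.
  by move=> zT; rewrite /int -zT; exact: (integral_id phi).
have intD z w : int z -> int w -> int (z + w).
  by rewrite /int rmorphD; apply: integral_add.
have intM z w : int z -> int w -> int (z * w).
  by rewrite /int rmorphM; apply: integral_mul.
have /choice[aj ajP] : forall j, exists a, [/\ res T a = a, a != 0 & int (a * 'X_j)].
  move=> j; have [jT|jT] := boolP (j \in T).
    exists 1; rewrite rmorph1 oner_eq0 mul1r; split=> //; apply: intT.
    by rewrite resX jT.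
  have [F [FT F1 PF]] := dep_poly Tmax.1 jT (Tmax.2 j jT).
  have F0 : F != 0 by rewrite -size_poly_gt0; lia.
  have coefT k : res T F`_k = F`_k by rewrite -coef_map FT.
  case sF: (size F) F1 => [|[|m]] // _.
  pose a := lead_coef F; exists a; split.
  - by rewrite /a lead_coefE coefT.
  - by rewrite lead_coef_eq0.
  have aE : a = F`_m.+1 by rewrite /a lead_coefE sF.
  (* Coefficients of the monic polynomial G with G(a x) = a^m F(x). *)
  pose E k := if k == m.+1 then 1 else F`_k * a ^+ (m - k).
  pose G := \poly_(k < m.+2) E k.
  have ET k : res T (E k) = E k.
    by rewrite /E; case: eqP => _; rewrite ?rmorph1 // rmorphM rmorphXn /= aE !coefT.
  exists G.
    by rewrite monicE /G lead_coef_poly /E ?eqxx ?oner_eq0.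
  apply/rootP; rewrite map_phi; apply/piP.
  have -> : map_poly (res T) G = G.
    by apply/polyP => k; rewrite coef_map coef_poly; case: ifP => _; [exact: ET | exact: rmorph0].
  have -> : G.[a * 'X_j] = a ^+ m * F.['X_j]; last exact: PM.
  rewrite horner_poly horner_coef sF mulr_sumr; apply: eq_bigr => k _.
  rewrite /E; case: eqVneq => [->|km]; first by rewrite -aE exprMn exprS; ring.
  have km' : (k <= m)%N by have := ltn_ord k; lia.
  by rewrite exprMn (_ : a ^+ m = a ^+ (m - k) * a ^+ k); [ring | rewrite -exprD subnK].
pose a := \prod_j aj j.
have prodT (S : pred 'I_n) : res T (\prod_(j | S j) aj j) = \prod_(j | S j) aj j.
  by rewrite rmorph_prod; apply: eq_bigr => j _; case: (ajP j).
have aX j : int (a * 'X_j).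
  rewrite /a (bigD1 j) //= mulrAC; apply: intM.
    by case: (ajP j).
  exact: intT.
exists a; split; first exact: prodT.
  by apply/prodf_neq0 => j _; case: (ajP j).
move=> g.
have [N [chi chim /rootP]] : exists N, int (a ^+ N * g).
  elim/mpoly_ring_ind: g => [c|i|p q [N pN] [N' qN]|p q [N pN] [N' qN]].
  - by exists 0%N; apply: intT; rewrite expr0 mul1r resC.
  - by exists 1%N.
  - exists (N + N')%N; rewrite mulrDr exprD -[X in _ + X]mulrA mulrAC.
    have aT k : int (a ^+ k) by apply: intT; rewrite rmorphXn /= prodT.
    by apply: intD; [rewrite mulrC|]; apply: intM => //; rewrite mulrC.
  - exists (N + N')%N; rewrite exprD mulrACA; exact: intM.
rewrite map_phi => /piP Pchi.
exists N, (map_poly (res T) chi); split=> //; first exact: monic_map.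
by apply/polyP => k; rewrite !coef_map /= res_id.
Qed.

(** In the monic relation for a^N f, factors of the indeterminate cancel because a^N f is outside
    the prime P. The first nonzero constant term is then a multiple of f modulo P. *)
Lemma ex_multiple_in_T f : ~ P f ->
  exists a, exists g, [/\ res T a = a, a <> 0 & P (a - g * f)].
Proof.
move=> nPf; have [Pi P1 Ppr] := Pp.
have [a [aT a0 /(_ f)[N [chi [chim chiT Pchi]]]]] := integral_mod.
have nPh : ~ P (a ^+ N * f).
  case/Ppr => // /primeX => /(_ Pp)/(Tmax.1 _ aT)/eqP.
  by rewrite (negPf a0).
have {chim} := monic_neq0 chim; move: Pchi chiT.
elim/poly_ind: chi => [|chi c IH]; first by rewrite eqxx.
rewrite hornerD hornerM hornerX hornerC => Pchi chiT chi0.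
have cT : res T c = c.
  by have := congr1 (fun q : {poly A} => q`_0) chiT;
    rewrite coef_map /= coefD coefMX coefC eqxx add0r.
have [c0|/eqP c0] := eqVneq c 0; last first.
  exists c, (- (chi.[a ^+ N * f] * a ^+ N)); split=> //.
  by rewrite mulNr opprK addrC -mulrA.
move: Pchi chiT chi0; rewrite c0 !addr0 => Pchi chiT chi0; apply: IH.
- by case/Ppr: Pchi.
- apply: (@mulIf _ 'X); rewrite ?polyX_eq0 //.
  by rewrite -[RHS]chiT rmorphM /= map_polyX.
- by apply: contra chi0 => /eqP->; rewrite mul0r.
Qed.

End Integrality.

Lemma indep_strict P Q T : is_prime_ideal P -> is_ideal Q ->
  (forall p, P p -> Q p) -> (exists p, Q p /\ ~ P p) -> indep Q T ->
  exists2 j, j \notin T & indep P (j |: T).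
Proof.
move=> Pp [_ QD QM] PQ [f [Qf nPf]] QT; apply: contrapT => no.
have Tmax : max_indep P T.
  split; first exact: indep_subideal QT.
  by move=> j jT ji; apply: no; exists j.
have [a [g [aT a0 Pa]]] := ex_multiple_in_T Pp Tmax nPf.
apply/a0/QT => //; rewrite -(subrK (g * f) a); apply: QD; first exact: PQ.
exact: QM.
Qed.

Lemma prime_chain_indep P e : prime_chain P e ->
  exists2 T : {set 'I_n}, #|T| = e & indep P T.
Proof.
elim: e P => [|e IH] P [C [CP Cprime Cstrict]].
  exists set0; first exact: cards0.
  have [Ci C1 _] := Cprime 0%N isT.
  by apply: (@indep_subideal _ (C 0%N)) (indep0 Ci C1) => p /CP.
have [|T Te Ti] := IH (C 1%N).
  exists (fun i => C i.+1); split=> // i ie; first exact: Cprime.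
  exact: Cstrict.
have [C01 ex01] := Cstrict 0%N isT.
have [C1i _ _] := Cprime 1%N isT.
have [j jT ji] := indep_strict (Cprime 0%N isT) C1i C01 ex01 Ti.
exists (j |: T); first by rewrite cardsU1 jT Te.
by apply: indep_subideal ji => p /CP.
Qed.

(** An ideal maximal among those avoiding the multiplicative set of nonzero polynomials in T is
    prime. *)
Lemma ex_prime_avoiding J T : is_ideal J -> indep J T ->
  exists Q, [/\ is_prime_ideal Q, (forall p, J p -> Q p) & indep Q T].
Proof.
move=> Ji JT.
pose good (X : A -> Prop) := [/\ is_ideal X, (forall p, J p -> X p) & indep X T].
pose good0 (X : A -> Prop) := (forall p, ~ X p) \/ good X.
have [F FG Ftot|Q [Q0 Qmax]] := @classical_sets.Zorn_bigcup _ good0.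
  have [[X FX [p Xp]]|no] := pselect (exists2 X, F X & exists p, X p); last first.
    by left=> p [X FX Xp]; apply: no; exists X => //; exists p.
  right; have goodF Y q : F Y -> Y q -> good Y by move=> /FG[/(_ q)|].
  have [[X0 XD XM] JX XT] := goodF _ _ FX Xp.
  split; last by move=> q qT [Y FY Yq]; have [_ _] := goodF _ _ FY Yq; apply.
    split; first by exists X.
      move=> q r [Y FY Yq] [Z FZ Zr].
      have [[Y0 YD YM] _ _] := goodF _ _ FY Yq; have [[Z0 ZD ZM] _ _] := goodF _ _ FZ Zr.
      case: (Ftot _ _ FY FZ) => YZ; [exists Z => //; apply: ZD | exists Y => //; apply: YD] => //.
        exact: YZ.
      exact: YZ.
    move=> q r [Y FY Yr]; have [[Y0 YD YM] _ _] := goodF _ _ FY Yr.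
    by exists Y => //; apply: YM.
  by move=> q Jq; exists X => //; apply: JX.
have goodJ : good J by [].
have gQ : good Q.
  case: Q0 => // nQ; case: (Qmax J); last by right.
  split; first by move=> p /nQ.
  by move=> JQ; apply: (nQ 0); apply: JQ; case: Ji.
have [[Q00 QD QM] JQ QT] := gQ; have Qi : is_ideal Q by [].
have ext x : ~ Q x -> exists a, exists g, [/\ res T a = a, a <> 0 & Q (a - g * x)].
  move=> nQx; apply: contrapT => no.
  pose X p := exists q, exists g, Q q /\ p = q + g * x.
  case: (Qmax X).
    split=> [p Qp|XQ]; first by exists p, 0; rewrite mul0r addr0.
    by apply/nQx/XQ; exists 0, 1; rewrite add0r mul1r.
  right; split.
  - split; first by exists 0, 0; rewrite mul0r addr0.
      move=> _ _ [q [g [Qq ->]]] [q' [g' [Qq' ->]]].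
      by exists (q + q'), (g + g'); split; [exact: QD | ring].
    move=> p _ [q [g [Qq ->]]]; exists (p * q), (p * g); split; first exact: QM.
    by ring.
  - by move=> p /JQ Qp; exists p, 0; rewrite mul0r addr0.
  - move=> p pT [q [g [Qq pE]]]; apply: contrapT => p0; apply: no.
    by exists p, g; split=> //; rewrite pE addrK.
exists Q; split=> //; split=> //.
  move=> Q1; have /eqP := QT 1 (rmorph1 _) Q1; by rewrite oner_eq0.
move=> x y Qxy; have [Qx|nQx] := pselect (Q x); first by left.
right; apply: contrapT => nQy.
have [a [g [aT a0 Qa]]] := ext _ nQx; have [b [h [bT b0 Qb]]] := ext _ nQy.
have /eqP : a * b = 0.
  apply: QT; first by rewrite rmorphM /= aT bT.
  have -> : a * b = a * (b - h * y) + (h * y) * (a - g * x) + (g * h) * (x * y) by ring.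
  by apply: (QD); [apply: QD|]; apply: (QM).
by rewrite mulf_eq0 => /orP[] /eqP.
Qed.

Lemma ex_prime_above P T i : is_prime_ideal P -> max_indep P T -> i \in T ->
  exists Q, [/\ is_prime_ideal Q, (forall p, P p -> Q p),
    (exists p, Q p /\ ~ P p) & indep Q (T :\ i)].
Proof.
move=> Pp Tmax iT; have [Pi P1 Ppr] := Pp; have [P0 PD PM] := Pi.
have [a [aT a0 aP]] := integral_mod Pp Tmax.
(* Integrality over the localization at a makes x_i = c a proper condition as
   soon as a does not vanish identically on x_i = c. *)
have [c c0] : exists c : R, (uni i a).[c%:MP] != 0.
  apply: contrapT => no.
  have ua0 : uni i a != 0 by rewrite -(rmorph0 (uni i)) (inj_eq (@uni_inj _ _ i)).
  have := max_poly_roots ua0 (rs := [seq (k%:R : R)%:MP | k <- iota 0 (size (uni i a))]).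
  rewrite size_map size_iota ltnn => H; apply: notF; apply: H.
    apply/allP => _ /mapP[k _ ->]; rewrite rootE; apply: contrapT => /negP c0.
    by apply: no; exists k%:R.
  rewrite map_inj_uniq ?iota_uniq // => k l /(congr1 (meval (fun=> 0))); rewrite !mevalC => /eqP.
  by rewrite eqr_nat => /eqP.
pose y : A := 'X_i - c%:MP.
have [at_c [at_cT at_cy at_ca]] : exists at_c : {rmorphism A -> A},
    [/\ forall p, res (T :\ i) p = p -> at_c p = p, at_c y = 0 & at_c a != 0].
  exists (horner_eval c%:MP \o uni i); split=> [p pT||] //=.
    rewrite -pT; apply: (@eq_rmorph_mpoly _ _ _
      (horner_eval c%:MP \o uni i \o res (T :\ i)) (res (T :\ i))) => [b|k] /=.
      by rewrite resC uniC /horner_eval hornerC.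
    rewrite resX !inE; case: ifP => [/andP[ki _]|_]; last by rewrite !rmorph0.
    by rewrite uniX (negPf ki) /horner_eval hornerC.
  by rewrite rmorphB /= uniX eqxx uniC /horner_eval !hornerE subrr.
have yT : res T y = y by rewrite rmorphB /= resX iT resC.
pose J p := exists q, exists g, P q /\ p = q + g * y.
have Ji : is_ideal J.
  split; first by exists 0, 0; rewrite mul0r addr0.
    move=> _ _ [q [g [Pq ->]]] [q' [g' [Pq' ->]]].
    by exists (q + q'), (g + g'); split; [exact: PD | ring].
  move=> p _ [q [g [Pq ->]]]; exists (p * q), (p * g); split; first exact: PM.
  by ring.
have JT : indep J (T :\ i).
  move=> b bT [q [g [Pq bE]]].
  have [N [chi [chim chiT Pchi]]] := aP g.
  pose r := (size chi).-1.
  have sr : size chi = r.+1 by rewrite /r prednK // size_poly_gt0 monic_neq0.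
  (* Multiply the integral relation of a^N g by y^r and replace g y by b modulo P: the result [E]
     lies in P and in R[x_T], so it is 0. At x_i = c only the top term a^(N r) b^r survives, which
     forces b = 0. *)
  pose E := \sum_(k < r.+1) chi`_k * a ^+ (N * k) * y ^+ (r - k) * b ^+ k.
  have bT' : res T b = b by apply: res_sub bT; exact: subsetDl.
  have E0 : E = 0.
    apply: Tmax.1.
      rewrite rmorph_sum; apply: eq_bigr => k _.
      by rewrite !rmorphM !rmorphXn /= aT yT bT' -coef_map chiT.
    have -> : E = y ^+ r * chi.[a ^+ N * g] +
        \sum_(k < r.+1) chi`_k * a ^+ (N * k) * y ^+ (r - k) * (b ^+ k - (g * y) ^+ k).
      rewrite horner_coef sr mulr_sumr -big_split; apply: eq_bigr => k _ /=.
      have kr : (k <= r)%N by rewrite -ltnS.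
      rewrite (_ : y ^+ r = y ^+ (r - k) * y ^+ k); last by rewrite -exprD subnK.
      by rewrite !exprMn -exprM; ring.
    apply: PD; first exact: PM.
    apply: ideal_sum => // k _; apply: PM; apply: idealX_sub => //.
    by rewrite bE addrK.
  have /eqP : at_c E = 0 by rewrite E0 rmorph0.
  rewrite rmorph_sum big_ord_recr /= big1 => [|k _]; last first.
    have kr : (0 < r - k)%N by rewrite subn_gt0.
    by rewrite !rmorphM !rmorphXn /= at_cy expr0n eqn0Ngt kr mulr0 mul0r.
  rewrite add0r !rmorphM !rmorphXn /= subnn expr0 mulr1 (at_cT b bT).
  have -> : chi`_r = 1 by have /monicP := chim; rewrite lead_coefE.
  rewrite rmorph1 mul1r mulf_eq0 !expf_eq0 (negPf at_ca) !andbF /=.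
  by case/andP=> _ /eqP.
have [Q [Qp JQ QT]] := ex_prime_avoiding Ji JT.
exists Q; split=> //.
  by move=> p Pp'; apply: JQ; exists p, 0; rewrite mul0r addr0.
exists y; split; first by apply: JQ; exists 0, 1; rewrite add0r mul1r.
move=> Py; have /eqP := Tmax.1 _ yT Py.
rewrite subr_eq0 => /eqP /(congr1 (fun p => p.@[fun=> c + 1])).
rewrite mevalXU mevalC => /eqP; rewrite -subr_eq0 addrAC subrr add0r oner_eq0 //.
Qed.

Lemma indep_prime_chain P T e : is_prime_ideal P -> indep P T ->
  (e <= #|T|)%N -> prime_chain P e.
Proof.
elim: e P T => [|e IH] P T Pp Ti eT.
  by exists (fun=> P); split.
have [U TU Umax] := ex_max_indep Ti.
have [i iU] : exists i, i \in U.
  by apply/card_gt0P; have := subset_leq_card TU; lia.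
have [Q [Qp PQ exQ QU]] := ex_prime_above Pp Umax iU.
have [|C [CQ Cp Cs]] := IH Q _ Qp QU.
  by have := subset_leq_card TU; have := cardsD1 i U; rewrite iU; lia.
exists (fun k => if k is k'.+1 then C k' else P); split=> //.
  by case=> // k ke; apply: Cp.
case=> [_|k ke]; last exact: Cs.
split; first by move=> p /PQ /CQ.
by have [p [Qq nPp]] := exQ; exists p; split=> //; apply/CQ.
Qed.

End Independence.

(** * Manifolds inside algebraic sets *)

Section Continuity.

Variables (R : realType) (n : nat).
Local Notation A := {mpoly R[n]}.

Lemma near_ptW (e r : R) (x y : 'I_n -> R) : e <= r -> near_pt e x y -> near_pt r x y.
Proof. by move=> er xy i; apply: lt_le_trans er. Qed.

Lemma near_pt_refl (e : R) (x : 'I_n -> R) : 0 < e -> near_pt e x x.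
Proof. by move=> e0 i; rewrite subrr normr0. Qed.

Lemma meval_cont (p : A) (x : 'I_n -> R) (e : R) : 0 < e ->
  exists2 r : R, 0 < r & forall y, near_pt r x y -> `|p.@[y] - p.@[x]| < e.
Proof.
elim/mpoly_ring_ind: p e => [c|i|p q IHp IHq|p q IHp IHq] e e0.
- by exists 1 => // y _; rewrite !mevalC subrr normr0.
- by exists e => // y /(_ i); rewrite !mevalXU.
- have e20 : 0 < e / 2 by rewrite divr_gt0.
  have [r r0 rP] := IHp _ e20; have [s s0 sP] := IHq _ e20.
  exists (Num.min r s) => [|y xy]; first by rewrite lt_min r0.
  have /rP : near_pt r x y by apply: near_ptW xy; rewrite ge_min lexx.
  have /sP : near_pt s x y by apply: near_ptW xy; rewrite ge_min lexx orbT.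
  rewrite !mevalD !ltr_norml; lra.
have a0 : 0 <= `|p.@[x]| by []; have b0 : 0 <= `|q.@[x]| by [].
pose a := `|p.@[x]|; pose b := `|q.@[x]|.
have e10 : 0 < Num.min 1 (e / (2 * (b + 1))).
  by rewrite lt_min ltr01 divr_gt0 // mulr_gt0 // ltr_wpDl.
have e20 : 0 < e / (2 * (a + 1)) by rewrite divr_gt0 // mulr_gt0 // ltr_wpDl.
have [r r0 rP] := IHp _ e10; have [s s0 sP] := IHq _ e20.
exists (Num.min r s) => [|y xy]; first by rewrite lt_min r0.
have /rP : near_pt r x y by apply: near_ptW xy; rewrite ge_min lexx.
have /sP : near_pt s x y by apply: near_ptW xy; rewrite ge_min lexx orbT.
rewrite !mevalM lt_min => hq /andP[hp1 hp].
have -> : p.@[y] * q.@[y] - p.@[x] * q.@[x] =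
  p.@[y] * (q.@[y] - q.@[x]) + (p.@[y] - p.@[x]) * q.@[x] by ring.
apply: le_lt_trans (ler_normD _ _) _; rewrite !normrM.
have py : `|p.@[y]| <= a + 1.
  rewrite -(subrK p.@[x] p.@[y]); apply: le_trans (ler_normD _ _) _.
  by rewrite addrC lerD2l ltW.
have h1 : `|p.@[y]| * `|q.@[y] - q.@[x]| <= (a + 1) * `|q.@[y] - q.@[x]|.
  by rewrite ler_wpM2r.
have h2 : (a + 1) * `|q.@[y] - q.@[x]| < e / 2.
  move: hq; rewrite ltr_pdivlMr ?mulr_gt0 ?ltr_wpDl // => hq.
  by rewrite ltr_pdivlMr // mulrAC mulrC mulrA mulrAC -mulrA.
have h3 : `|p.@[y] - p.@[x]| * b <= e / 2.
  move: hp; rewrite ltr_pdivlMr ?mulr_gt0 ?ltr_wpDl // => hp.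
  rewrite ler_pdivlMr //; apply: le_trans (ltW hp).
  by rewrite -mulrA ler_wpM2l // mulrC ler_pM2l // lerDl.
by rewrite -/b; lra.
Qed.

Lemma meval_neq0_near (p : A) (x : 'I_n -> R) : p.@[x] != 0 ->
  exists2 r : R, 0 < r & forall y, near_pt r x y -> p.@[y] != 0.
Proof.
move=> px; have px0 : 0 < `|p.@[x]| by rewrite normr_gt0.
have [r r0 rP] := meval_cont p x px0; exists r => // y /rP py.
by apply: contraTneq py => ->; rewrite sub0r normrN ltxx.
Qed.

End Continuity.

(** * Upper bound for the dimension of a chart *)

Section UpperBound.

Variables (R : realType) (d n : nat).
Local Notation A := {mpoly R[n]}.
Variables (U : ('I_d -> R) -> Prop) (psi : ('I_d -> R) -> ('I_n -> R)).
Hypotheses (Uo : open_set U) (psic : continuous_on U psi).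
Hypothesis psi_inj : forall u v, U u -> U v -> psi u = psi v -> u = v.

Let V := vanishing_ideal (fun y : 'I_n -> R => exists2 u, U u & psi u = y).

Lemma vanishing_is_ideal m (S : ('I_m -> R) -> Prop) : is_ideal (vanishing_ideal S).
Proof.
split=> [x _|p q Vp Vq x Sx|p q Vq x Sx]; first exact: meval0.
  by rewrite mevalD Vp // Vq // addr0.
by rewrite mevalM Vq // mulr0.
Qed.

(** For T maximal, each coordinate outside T is, on a small cube, a root of a nonzero polynomial
    whose coefficients depend only on the coordinates in T. This bounds the fibres, against
    [large_fibre] if #|T| < d. *)
Lemma chart_indep (u0 : 'I_d -> R) : U u0 -> exists2 T : {set 'I_n}, (d <= #|T|)%N & indep V T.
Proof.
move=> Uu0.
have Vi : is_ideal V by exact: vanishing_is_ideal.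
have V1 : ~ V 1.
  by move=> /(_ (psi u0)) => /(_ (ex_intro2 _ _ u0 Uu0 erefl))/eqP; rewrite meval1 oner_eq0.
have [T _ Tmax] := ex_max_indep (indep0 Vi V1).
exists T; last exact: Tmax.1.
rewrite leqNgt; apply/negP => Td.
have /choice[F FP] : forall j, exists F : {poly A}, j \notin T ->
    [/\ map_poly (res T) F = F, (1 < size F)%N & V F.['X_j]].
  move=> j; have [jT|jT] := boolP (j \in T); first by exists 0.
  by have [F FP] := dep_poly Tmax.1 jT (Tmax.2 j jT); exists F.
have coefT j k : j \notin T -> res T (F j)`_k = (F j)`_k.
  by move=> /FP[FT _ _]; rewrite -coef_map FT.
pose a := \prod_(j | j \notin T) lead_coef (F j).
have aT : res T a = a.
  rewrite rmorph_prod; apply: eq_bigr => j jT.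
  by rewrite lead_coefE; apply: coefT.
have a0 : a != 0.
  apply/prodf_neq0 => j /FP[_ F1 _]; rewrite lead_coef_eq0 -size_poly_gt0; exact: ltnW F1.
have [u1 Uu1 au1] : exists2 u1, U u1 & a.@[psi u1] != 0.
  apply: contrapT => no; move/eqP: a0; apply; apply: Tmax.1 aT _ => _ [u Uu <-].
  by apply/eqP; apply: contrapT => /negP au; apply: no; exists u.
have [r r0 rP] := meval_neq0_near au1.
have [s s0 sP] := psic Uu1 r0.
have [t t0 tP] := Uo Uu1.
pose h := Num.min s t / 2.
have m0 : 0 < Num.min s t by rewrite lt_min s0.
have ms : Num.min s t <= s by rewrite ge_min lexx.
have mt : Num.min s t <= t by rewrite ge_min lexx orbT.
have h0 : 0 < h by rewrite divr_gt0.
have hs : h < s by rewrite /h; lra.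
have ht : h < t by rewrite /h; lra.
(* Maps the unit cube onto a cube with corner [u1] and side [h], on which [a] does not vanish. *)
pose sc (c : 'I_d -> R) k := u1 k + h * c k.
have sc_near c : unit_cube c -> near_pt s u1 (sc c) /\ near_pt t u1 (sc c).
  move=> cc; suff H : forall k, `|sc c k - u1 k| <= h.
    by split=> k; apply: le_lt_trans (H k) _.
  move=> k; have /andP[c0 c1] := cc k.
  rewrite /sc addrC addKr ger0_norm; last by rewrite mulr_ge0 // ltW.
  by apply: ler_piMr => //; apply: ltW.
have scU c : unit_cube c -> U (sc c) by move=> /sc_near[_ /tP].
have sca c : unit_cube c -> a.@[psi (sc c)] != 0.
  by move=> cc; apply: rP; apply: sP; [exact: scU | exact: (sc_near c cc).1].
pose g c := psi (sc c).
have gcont : continuous_on (@unit_cube R d) g.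
  move=> c cc e e0; have [q q0 qP] := psic (scU c cc) e0.
  exists (q / h) => [|c' cc' c'n]; first by rewrite divr_gt0.
  apply: qP; first exact: scU.
  move=> k; rewrite /sc opprD addrACA subrr add0r -mulrBr normrM gtr0_norm // mulrC.
  by rewrite -ltr_pdivlMr.
(* The added 2 covers the linear polynomials attached to coordinates in T; [N] exceeds the number of
   codes below. *)
pose M := (\sum_j size (F j)).+2.
pose N := (M.+1 ^ n).+1.
have [p [pinj pc] pT] := large_fibre gcont Td N.
pose y k := g (p k).
pose f j : {poly R} := if j \in T then 'X - (y ord0 j)%:P else map_poly (meval (y ord0)) (F j).
have f0 j : f j != 0.
  rewrite /f; case: ifPn => jT; first by rewrite polyXsubC_eq0.
  apply: contra (sca _ (pc ord0)) => /eqP fj0; rewrite -/(y ord0) /a rmorph_prod /=.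
  rewrite (bigD1 j) //= lead_coefE -coef_map fj0 coef0 mul0r //.
have fM j : (size (f j) <= M)%N.
  rewrite /f; case: ifPn => jT; first by rewrite size_XsubC.
  apply/leq_sizeP => k Mk; rewrite coef_map nth_default; first exact: meval0.
  apply: leq_trans Mk; rewrite /M (bigD1 j) //= -addn2 -addnA; exact: leq_addr.
have froot j k : root (f j) (y k j).
  rewrite /f; case: ifPn => jT.
    by rewrite root_XsubC; apply/eqP; exact: pT.
  have -> : map_poly (meval (y ord0)) (F j) = map_poly (meval (y k)) (F j).
    apply/polyP => l; rewrite !coef_map /=; apply: meval_res (coefT _ _ jT) _ => i iT.
    exact: pT.
  have [_ _ VF] := FP _ jT; rewrite rootE.
  have := VF (y k) (ex_intro2 _ _ (sc (p k)) (scU _ (pc k)) erefl).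
  by rewrite meval_horner mevalXU => ->.
pose rs j := undup [seq y k j | k <- enum 'I_N].
have rsM j : (size (rs j) < M.+1)%N.
  rewrite ltnS; apply: leq_trans (fM j); apply: ltnW.
  apply: max_poly_roots (f0 j) _ (undup_uniq _).
  by apply/allP => z; rewrite mem_undup => /mapP[k _ ->].
(* A point is coded by the position of each of its coordinates among the values taken on the
   fibre. *)
pose code k : {ffun 'I_n -> 'I_M.+1} := [ffun j => inord (index (y k j) (rs j))].
have code_inj : injective code.
  move=> k l kl; apply: pinj.
  have ykl : y k = y l.
    apply: funext => j; have /(congr1 val) := congr1 (fun c : {ffun _} => c j) kl.
    have yin q : y q j \in rs j.
      by rewrite mem_undup; apply/mapP; exists q; rewrite ?mem_enum.
    have lt q : (index (y q j) (rs j) < M.+1)%N.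
      by apply: leq_trans (ltnW (rsM j)); rewrite index_mem.
    rewrite !ffunE /= !inordK // => E.
    by rewrite -(nth_index 0 (yin k)) E nth_index.
  have := psi_inj (scU _ (pc k)) (scU _ (pc l)) ykl => E.
  apply: funext => j; have := congr1 (fun c => c j) E; rewrite /sc => /addrI.
  by apply: mulfI; rewrite gt_eqF.
by have := leq_card code code_inj; rewrite card_ffun !card_ord ltnn.
Qed.

End UpperBound.

(** * Simple roots of polynomials *)

Section ImplicitRoot.

Variables (R : realType) (n : nat).

Lemma meval_gt0_near (p : {mpoly R[n]}) (x : 'I_n -> R) : 0 < p.@[x] ->
  exists2 r : R, 0 < r & forall y, near_pt r x y -> 0 < p.@[y].
Proof.
move=> px; have [r r0 rP] := meval_cont p x px; exists r => // y /rP.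
rewrite ltr_norml; lra.
Qed.

Variables (G : ('I_n -> R) -> {poly R}) (x : 'I_n -> R) (t0 r0 : R).
Hypothesis Gcont : forall t y e, 0 < e -> exists2 s : R, 0 < s &
  forall z, near_pt s y z -> `|(G z).[t] - (G y).[t]| < e.
Hypotheses (Gx0 : (G x).[t0] = 0) (r0_gt0 : 0 < r0).
Hypothesis dG : forall y t, near_pt r0 x y -> `|t - t0| < r0 -> 0 < ((G y)^`()).[t].

Let incr y s t : near_pt r0 x y -> `|s - t0| < r0 -> `|t - t0| < r0 -> s < t ->
  (G y).[s] < (G y).[t].
Proof.
move=> xy s0 t1 st; have [c] := polyrcf.poly_mvt (G y) st.
rewrite in_itv /= => /andP[sc ct] E; rewrite -subr_gt0 E mulr_gt0 ?subr_gt0 //.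
by apply: dG => //; move: s0 t1; rewrite !ltr_norml; lra.
Qed.

Let pos_near y t : 0 < (G y).[t] -> exists2 s : R, 0 < s &
  forall z, near_pt s y z -> 0 < (G z).[t].
Proof.
move=> py; have [s s0 sP] := Gcont t y py; exists s => // z /sP.
rewrite ltr_norml; lra.
Qed.

Let neg_near y t : (G y).[t] < 0 -> exists2 s : R, 0 < s &
  forall z, near_pt s y z -> (G z).[t] < 0.
Proof.
rewrite -oppr_gt0 => py; have [s s0 sP] := Gcont t y py; exists s => // z /sP.
rewrite ltr_norml; lra.
Qed.

(** Near [t0] the function is strictly increasing in t by the mean value theorem. Its signs on both
    sides of [t0] persist for nearby y and enclose a root; enclosing the root more tightly in the
    same way gives continuity. *)
Lemma implicit_root : exists2 r : R, 0 < r & exists th : ('I_n -> R) -> R,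
  [/\ th x = t0, forall y, near_pt r x y -> (G y).[th y] = 0 &
      forall y, near_pt r x y -> forall e, 0 < e -> exists2 s : R, 0 < s &
        forall z, near_pt r x z -> near_pt s y z -> `|th z - th y| < e].
Proof.
pose e0 := r0 / 2.
have e00 : 0 < e0 by rewrite divr_gt0.
have r0E : r0 = e0 + e0 by rewrite /e0; lra.
have inr t : `|t - t0| <= e0 -> `|t - t0| < r0.
  by move=> h; apply: le_lt_trans h _; rewrite r0E ltrDl.
have t0r : `|t0 - t0| < r0 by rewrite subrr normr0.
have xx : near_pt r0 x x by exact: near_pt_refl.
have ep : `|t0 + e0 - t0| <= e0 by rewrite addrC addKr ger0_norm // ltW.
have em : `|t0 - e0 - t0| <= e0 by rewrite addrC addKr normrN ger0_norm // ltW.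
have [s1 s10 s1P] : exists2 s : R, 0 < s & forall y, near_pt s x y -> 0 < (G y).[t0 + e0].
  apply: pos_near; rewrite -Gx0; apply: incr => //; first exact: inr.
  by rewrite ltrDl.
have [s2 s20 s2P] : exists2 s : R, 0 < s & forall y, near_pt s x y -> (G y).[t0 - e0] < 0.
  apply: neg_near; rewrite -Gx0; apply: incr => //; first exact: inr.
  by rewrite ltrBlDr ltrDl.
pose r := Num.min r0 (Num.min s1 s2).
have rr0 y : near_pt r x y -> near_pt r0 x y by apply: near_ptW; rewrite ge_min lexx.
have rs1 y : near_pt r x y -> near_pt s1 x y.
  by apply: near_ptW; rewrite !ge_min lexx orbT.
have rs2 y : near_pt r x y -> near_pt s2 x y.
  by apply: near_ptW; rewrite !ge_min lexx !orbT.
have r_gt0 : 0 < r by rewrite !lt_min r0_gt0 s10.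
have /choice[th thP] : forall y, exists t, near_pt r x y ->
    `|t - t0| <= e0 /\ (G y).[t] = 0.
  move=> y; have [xy|nxy] := pselect (near_pt r x y); last by exists 0.
  have h1 := s1P _ (rs1 _ xy); have h2 := s2P _ (rs2 _ xy).
  have [||t] := @polyrcf.poly_ivt _ (G y) (t0 - e0) (t0 + e0).
  - lra.
  - by rewrite nmulr_rle0 // ltW.
  rewrite in_itv /= => /andP[ta tb] /rootP tr; exists t => _; split=> //.
  by rewrite ler_norml; lra.
exists r => //; exists th; split.
- have [tx Gtx] := thP x (near_pt_refl x r_gt0).
  have [lt|gt|//] := ltgtP (th x) t0.
    by have := incr xx (inr _ tx) t0r lt; rewrite Gtx Gx0 ltxx.
  by have := incr xx t0r (inr _ tx) gt; rewrite Gtx Gx0 ltxx.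
- by move=> y /thP[].
move=> y xy e epos; have [ty Gty] := thP y xy.
(* The bound e0 / 2 keeps both th y - e1 and th y + e1 within distance r0 of [t0]. *)
pose e1 := Num.min e (e0 / 2).
have e10 : 0 < e1 by rewrite lt_min epos divr_gt0.
have e1e : e1 <= e by rewrite ge_min lexx.
have e1e0 : e1 <= e0 / 2 by rewrite ge_min lexx orbT.
have inp : `|th y + e1 - t0| < r0 by move: ty; rewrite ler_norml ltr_norml r0E; lra.
have inm : `|th y - e1 - t0| < r0 by move: ty; rewrite ler_norml ltr_norml r0E; lra.
have yp : 0 < (G y).[th y + e1].
  by rewrite -Gty; apply: incr; rewrite ?ltrDl //; [exact: rr0|exact: inr].
have ym : (G y).[th y - e1] < 0.
  by rewrite -Gty; apply: incr; rewrite ?ltrBlDr ?ltrDl //; [exact: rr0|exact: inr].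
have [s3 s30 s3P] := pos_near yp; have [s4 s40 s4P] := neg_near ym.
exists (Num.min s3 s4) => [|z xz yz]; first by rewrite lt_min s30.
have h3 : 0 < (G z).[th y + e1] by apply: s3P; apply: near_ptW yz; rewrite ge_min lexx.
have h4 : (G z).[th y - e1] < 0 by apply: s4P; apply: near_ptW yz; rewrite ge_min lexx orbT.
have [tz Gtz] := thP z xz.
rewrite ltr_distl; apply/andP; split.
  apply: le_lt_trans (_ : th y - e1 < _); first by rewrite lerB.
  rewrite ltNge le_eqVlt; apply/negP => /orP[/eqP E|lt].
    by move: h4; rewrite -E Gtz ltxx.
  by have := incr (rr0 _ xz) (inr _ tz) inm lt; rewrite Gtz ltNge ltW.
apply: lt_le_trans (_ : _ < th y + e1) _; last by rewrite lerD2l.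
rewrite ltNge le_eqVlt; apply/negP => /orP[/eqP E|lt].
  by move: h3; rewrite E Gtz ltxx.
by have := incr (rr0 _ xz) inp (inr _ tz) lt; rewrite Gtz ltNge ltW.
Qed.

End ImplicitRoot.

(** * Pseudo-division and minimal polynomials modulo a prime *)

Section MinimalPolynomial.

Variables (R : realType) (n : nat).
Local Notation A := {mpoly R[n]}.

Lemma pseudo_division (D : {set 'I_n}) (F q : {poly A}) :
  F != 0 -> map_poly (res D) F = F -> map_poly (res D) q = q ->
  exists N, exists h r : {poly A}, [/\ lead_coef F ^+ N *: q = h * F + r,
    (size r < size F)%N & map_poly (res D) r = r].
Proof.
move=> F0 FD; move: {2}(size q) (leqnn (size q)) => k; elim: k q => [|k IH] q.
  rewrite leqn0 size_poly_eq0 => /eqP -> _; exists 0%N, 0, 0.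
  by rewrite scaler0 mul0r addr0 size_poly0 size_poly_gt0 rmorph0.
move=> qk qD; have [qF|Fq] := ltnP (size q) (size F).
  by exists 0%N, 0, q; rewrite expr0 scale1r mul0r add0r.
pose w := lead_coef q *: 'X^(size q - size F).
pose q' := lead_coef F *: q - w * F.
have sF : (0 < size F)%N by rewrite size_poly_gt0.
have coefD (B : {poly A}) l : map_poly (res D) B = B -> res D B`_l = B`_l.
  by move=> BD; rewrite -coef_map BD.
have lcD (B : {poly A}) : map_poly (res D) B = B -> res D (lead_coef B) = lead_coef B.
  by move=> BD; rewrite lead_coefE coefD.
have q'D : map_poly (res D) q' = q'.
  by rewrite /q' /w rmorphB rmorphM /= !map_polyZ /= map_polyXn FD qD !lcD.
have q'k : (size q' <= k)%N.
  apply/leq_sizeP => l kl; rewrite /q' /w coefB coefZ -scalerAl coefZ coefXnM.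
  case: ltnP => lk; first by lia.
  have [E|NE] := eqVneq l (size q).-1.
    rewrite E (_ : (size q).-1 - (size q - size F) = (size F).-1)%N; last by lia.
    by rewrite -!lead_coefE mulrC subrr.
  have ql : (size q <= l)%N by lia.
  have Fl : (size F <= l - (size q - size F))%N by lia.
  by rewrite (nth_default _ ql) (nth_default _ Fl) !mulr0 subrr.
have [N [h [r [E rF rD]]]] := IH q' q'k q'D.
exists N.+1, (h + lead_coef F ^+ N *: w), r; split=> //.
by rewrite exprSr -scalerA mulrDl addrAC -E /q' scalerBr -[(_ *: w) * F]scalerAl subrK.
Qed.

(** F has least size among the relations for ['X_j] that are nonzero modulo P. Removing a leading
    term in P, or differentiating, would give a smaller one; the latter uses characteristic zero. *)
Lemma ex_minimal_poly (P : A -> Prop) (D : {set 'I_n}) j (F0 : {poly A}) :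
  is_prime_ideal P -> map_poly (res D) F0 = F0 -> P F0.['X_j] ->
  (exists k, ~ P F0`_k) ->
  exists F : {poly A}, [/\ map_poly (res D) F = F, P F.['X_j],
    ~ P (lead_coef F), ~ P (F^`()).['X_j] &
    forall r : {poly A}, map_poly (res D) r = r -> (size r < size F)%N ->
      P r.['X_j] -> forall k, P r`_k].
Proof.
move=> Pp F0D PF0 [k0 F0k]; have [Pi P1 Ppr] := Pp; have [P0 PD PM] := Pi.
pose cand (F : {poly A}) := [/\ map_poly (res D) F = F, P F.['X_j] & exists k, ~ P F`_k].
have [F [FD PF [k Fk]] Fmin] : exists2 F, cand F &
    forall r : {poly A}, (size r < size F)%N -> ~ cand r.
  move: {2}(size F0) (leqnn (size F0)) => m.
  have : cand F0 by split=> //; exists k0.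
  elim: m F0 {F0D PF0 k0 F0k} => [|m IH] F0 cF0 sF0.
    by exists F0 => // r; move: sF0; rewrite leqn0 => /eqP->.
  have [[r sr cr]|no] := pselect (exists2 r : {poly A}, (size r < size F0)%N & cand r).
    by apply: (IH r) => //; rewrite -ltnS; apply: leq_trans sF0.
  by exists F0 => // r sr cr; apply: no; exists r.
have min (r : {poly A}) : map_poly (res D) r = r -> (size r < size F)%N ->
    P r.['X_j] -> forall k, P r`_k.
  by move=> rD rF Pr l; apply: contrapT => nP; apply: (Fmin r rF); split=> //; exists l.
have sF : (0 < size F)%N.
  rewrite lt0n; apply/negP => /eqP s0; apply: Fk.
  by rewrite nth_default // s0.
pose m := (size F).-1; have mE : size F = m.+1 by rewrite /m prednK.
have coefD l : res D F`_l = F`_l by rewrite -coef_map FD.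
have nlc : ~ P (lead_coef F).
  rewrite lead_coefE -/m => Plc; apply: (Fmin (\poly_(i < m) F`_i)).
    by rewrite mE ltnS size_poly.
  split.
  - by apply/polyP => l; rewrite coef_map coef_poly /=; case: ifP; rewrite ?coefD ?rmorph0.
  - have -> : (\poly_(i < m) F`_i).['X_j] = F.['X_j] - F`_m * 'X_j ^+ m.
      by rewrite horner_poly horner_coef mE big_ord_recr /= addrK.
    by apply: idealB => //; apply: idealMr.
  - exists k; rewrite coef_poly; case: ltnP => // mk _; apply: Fk.
    have [->//|ne] := eqVneq k m; rewrite nth_default // mE.
    by lia.
have m0 : (0 < m)%N.
  rewrite lt0n; apply/negP => /eqP m0; apply: nlc.
  have FC : F = (F`_0)%:P by apply: size1_polyC; rewrite mE m0.
  by move: PF; rewrite FC hornerC lead_coefC.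
exists F; split=> // PdF.
have F0' : F != 0 by rewrite -size_poly_gt0.
have := min F^`() _ (lt_size_deriv F0') PdF m.-1.
rewrite -deriv_map FD coef_deriv prednK // => /(_ erefl) Pm.
apply: nlc; rewrite lead_coefE -/m.
have -> : F`_m = (m%:R^-1 : R)%:MP * (F`_m *+ m).
  rewrite -[F`_m *+ m]mulr_natl mulrA -mpolyC_nat -mpolyCM mulVf ?mpolyC1 ?mul1r //.
  by rewrite pnatr_eq0 -lt0n.
exact: PM.
Qed.

End MinimalPolynomial.

(** * Local sections of real varieties *)

Section LocalSection.

Variables (R : realType) (n : nat).
Local Notation A := {mpoly R[n]}.

Definition upd (x : 'I_n -> R) j t : 'I_n -> R := fun i => if i == j then t else x i.

Lemma upd_id x j : upd x j (x j) = x.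
Proof. by apply: funext => i; rewrite /upd; case: eqP => [->|]. Qed.

Lemma near_upd e x y j s t : near_pt e x y -> `|t - s| < e ->
  near_pt e (upd x j s) (upd y j t).
Proof. by move=> xy st i; rewrite /upd; case: eqP. Qed.

Lemma map_meval_upd (D : {set 'I_n}) (F : {poly A}) j y t : j \notin D ->
  map_poly (res D) F = F -> map_poly (meval (upd y j t)) F = map_poly (meval y) F.
Proof.
move=> jD FD; apply/polyP => k; rewrite !coef_map /=.
apply: (@meval_res _ _ D); first by rewrite -coef_map FD.
by move=> i iD; rewrite /upd; case: eqP => // ij; rewrite -ij iD in jD.
Qed.

Lemma meval_upd_horner (D : {set 'I_n}) (F : {poly A}) j y t : j \notin D ->
  map_poly (res D) F = F -> (F.['X_j]).@[upd y j t] = (map_poly (meval y) F).[t].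
Proof.
by move=> jD FD; rewrite meval_horner mevalXU /upd eqxx (map_meval_upd _ _ jD FD).
Qed.

Variables (P : A -> Prop) (T : {set 'I_n}).
Hypotheses (Pp : is_prime_ideal P) (Tmax : max_indep P T).

(** [f] expresses genericity of the base point. [Psi] depends on the coordinates in T as a section
    should, but satisfies only the relations of P in the variables of D, which will grow from T to
    all variables. *)
Let sections (D : {set 'I_n}) (f : A) := forall x, zero_set P x -> f.@[x] != 0 ->
  exists2 r : R, 0 < r & exists Psi : ('I_n -> R) -> ('I_n -> R),
    [/\ Psi x = x, forall u i, i \in T -> Psi u i = u i,
        forall u, near_pt r x u -> forall p, res D p = p -> P p -> p.@[Psi u] = 0 &
        continuous_on (near_pt r x) Psi].

(** The new coordinate is a simple root of a minimal polynomial F, followed by [implicit_root]. A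
    relation in [j |: D] then vanishes: its pseudo-remainder by F has coefficients in P by
    minimality, and the leading coefficient of F is nonzero nearby. *)
Lemma section_step (D : {set 'I_n}) j f : T \subset D -> j \notin D -> ~ P f ->
  sections D f -> exists2 f', ~ P f' & sections (j |: D) f'.
Proof.
move=> TD jD nPf secD; have [Pi P1 Ppr] := Pp; have [P0 PD PM] := Pi.
have jT : j \notin T by apply: contra jD; exact: (subsetP TD).
have [F0 [F0T F01 PF0]] := dep_poly Tmax.1 jT (Tmax.2 j jT).
have [||F [FD PF nlc ndF minF]] := @ex_minimal_poly _ _ P D j F0 Pp _ PF0.
- apply/polyP => k; rewrite coef_map; apply: res_sub TD _.
  by rewrite -coef_map F0T.
- exists (size F0).-1; rewrite -lead_coefE => Plc.
  have lc0 : lead_coef F0 = 0.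
    by apply: Tmax.1 Plc; rewrite lead_coefE -coef_map F0T.
  by move/eqP: lc0; rewrite lead_coef_eq0 => /eqP F00; rewrite F00 size_poly0 in F01.
have Fn0 : F != 0 by apply: contra_not_neq nlc => ->; rewrite lead_coef0.
pose dF := (F^`()).['X_j].
exists (f * (lead_coef F * dF)); first by case/Ppr=> // /Ppr[].
move=> x Vx; rewrite !mevalM !mulf_eq0 !negb_or => /and3P[fx lcx dFx].
have [r r0 [Psi [Psix PsiT PsiP Psic]]] := secD x Vx fx.
(* Scaling by [c] makes the derivative at the base point equal to c^2 > 0. *)
pose c := dF.@[x].
pose G y := c *: map_poly (meval y) F.
have dFD : map_poly (res D) F^`() = F^`() by rewrite -deriv_map FD.
have [r1 r10 r1P] : exists2 r : R, 0 < r & forall y, near_pt r x y -> 0 < (c%:MP * dF).@[y].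
  by apply: meval_gt0_near; rewrite mevalM mevalC -expr2 exprn_even_gt0.
have [t y e e0||||r2 r20 [th [thx thG thc]]] := @implicit_root R n G x (x j) r1.
- have [s s0 sP] := meval_cont (c%:MP * F.['X_j]) (upd y j t) e0.
  exists s => // z yz; rewrite /G !hornerZ -!(meval_upd_horner _ _ jD FD).
  have := sP (upd z j t); rewrite !mevalM !mevalC; apply.
  by apply: near_upd; rewrite // subrr normr0.
- by rewrite /G hornerZ -(meval_upd_horner _ _ jD FD) upd_id (Vx _ PF) mulr0.
- by [].
- move=> y t xy tx; rewrite /G derivZ hornerZ deriv_map -(meval_upd_horner _ _ jD dFD).
  have := r1P (upd y j t); rewrite mevalM mevalC; apply.
  by rewrite -[x in near_pt _ x _](upd_id x j); apply: near_upd.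
have [r3 r30 r3P] := meval_neq0_near lcx.
pose r4 := Num.min r2 r3.
have r40 : 0 < r4 by rewrite lt_min r20.
have [r5 r50 r5P] := Psic x (near_pt_refl x r0) _ r40.
pose r6 := Num.min r r5.
have r6r y : near_pt r6 x y -> near_pt r x y by apply: near_ptW; rewrite ge_min lexx.
have r6n y : near_pt r6 x y -> near_pt r4 x (Psi y).
  move=> xy; rewrite -[x in near_pt _ x _]Psix; apply: r5P; first exact: r6r.
  by apply: near_ptW xy; rewrite ge_min lexx orbT.
have r42 y : near_pt r4 x y -> near_pt r2 x y by apply: near_ptW; rewrite ge_min lexx.
exists r6; first by rewrite lt_min r0.
exists (fun u => upd (Psi u) j (th (Psi u))); split.
- by rewrite Psix thx upd_id.
- move=> u i iT; rewrite /upd; case: eqP => [ij|_]; last exact: PsiT.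
  by rewrite ij (negPf jT) in iT.
- move=> u xu p pD Pp'.
  have uD : map_poly (res D) (uni j p) = uni j p by rewrite -(uni_res p jD) pD.
  have [N [h [q [E qF qD]]]] := pseudo_division Fn0 FD uD.
  have Ej : lead_coef F ^+ N * p = h.['X_j] * F.['X_j] + q.['X_j].
    by rewrite -hornerM -hornerD -E hornerZ uniK.
  have Pq : P q.['X_j].
    have -> : q.['X_j] = lead_coef F ^+ N * p - h.['X_j] * F.['X_j] by rewrite Ej addrC addKr.
    by apply: idealB => //; apply: (PM).
  set z := upd _ _ _.
  have qz : (q.['X_j]).@[z] = 0.
    rewrite (meval_upd_horner _ _ jD qD).
    have -> : map_poly (meval (Psi u)) q = 0; last by rewrite horner0.
    apply/polyP => k; rewrite coef_map coef0 /=; apply: PsiP; first exact: r6r.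
      by rewrite -coef_map qD.
    exact: minF.
  have Fz : (F.['X_j]).@[z] = 0.
    have := thG _ (r42 _ (r6n _ xu)); rewrite /G hornerZ => /eqP.
    by rewrite mulf_eq0 (negPf dFx) (meval_upd_horner _ _ jD FD) => /eqP.
  have lcz : (lead_coef F).@[z] != 0.
    have -> : (lead_coef F).@[z] = (lead_coef F).@[Psi u].
      apply: (@meval_res _ _ D); first by rewrite lead_coefE -coef_map FD.
      by move=> i iD; rewrite /z /upd; case: eqP => // ij; rewrite -ij iD in jD.
    by apply: r3P; apply: near_ptW (r6n _ xu); rewrite ge_min lexx orbT.
  have := congr1 (meval z) Ej; rewrite mevalD !mevalM Fz qz mulr0 addr0 => /eqP.
  by rewrite mulf_eq0 rmorphXn /= expf_eq0 (negPf lcz) andbF => /eqP.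
- move=> u xu e e0.
  have [s s0 sP] := thc _ (r42 _ (r6n _ xu)) e e0.
  have m0 : 0 < Num.min e s by rewrite lt_min e0.
  have [q q0 qP] := Psic u (r6r _ xu) _ m0.
  exists q => // v xv uv; have Puv := qP v (r6r _ xv) uv.
  apply: near_upd; first by apply: near_ptW Puv; rewrite ge_min lexx.
  apply: sP; first exact/r42/r6n.
  by apply: near_ptW Puv; rewrite ge_min lexx orbT.
Qed.

(** For D = T the identity works, since P contains no nonzero polynomial in T; the other variables
    are adjoined one by one. *)
Lemma local_section : exists2 f, ~ P f & sections [set: 'I_n] f.
Proof.
suff [f nPf secf] : exists2 f, ~ P f & sections (T :|: [set i in enum 'I_n]) f.
  exists f; first exact: nPf.
  move: secf; congr (sections _ f).
  by apply/setP => i; rewrite !inE mem_enum orbT.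
elim: (enum 'I_n) => [|j s [f nPf secf]].
  exists 1; first by case: Pp.
  move=> x Vx _; exists 1 => //; exists id; split=> //.
    move=> u _ p pT Pp'; have -> : p = 0; last exact: meval0.
    by apply: Tmax.1 Pp'; move: pT; rewrite set_nil setU0.
  by move=> u _ e e0; exists e.
have [jD|jD] := boolP (j \in T :|: [set i in s]).
  exists f; first exact: nPf.
  suff -> : T :|: [set i in j :: s] = T :|: [set i in s] by [].
  apply/setP => i; move: jD; rewrite !inE.
  by case: (eqVneq i j) => [->|//]; rewrite orbT => ->.
have [f' nPf' secf'] := section_step (subsetUl _ _) jD nPf secf.
exists f'; first exact: nPf'.
suff -> : T :|: [set i in j :: s] = j |: (T :|: [set i in s]) by [].
by apply/setP => i; rewrite !inE orbCA.
Qed.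

End LocalSection.

(** * A manifold through a generic point *)

Section Manifold.

Variables (R : realType) (n : nat).
Local Notation A := {mpoly R[n]}.
Variables (P : A -> Prop) (T : {set 'I_n}) (S : ('I_n -> R) -> Prop).
Hypotheses (Pp : is_prime_ideal P) (Tmax : max_indep P T).
Hypothesis Sa : semialgebraic S.
Hypothesis SP : forall p, vanishing_ideal (fun x => S x /\ zero_set P x) p -> P p.

Lemma near_pt_open m (r : R) (x : 'I_m -> R) : open_set (near_pt r x).
Proof.
move=> y xy; pose e := \big[Num.min/1]_(i < m) (r - `|y i - x i|).
exists e.
  rewrite /e; elim/big_ind: _ => // [a b a0 b0|i _]; first by rewrite lt_min a0.
  by rewrite subr_gt0.
move=> z yz i; have : `|z i - y i| < r - `|y i - x i|.
  by apply: lt_le_trans (yz i) _; exact: bigmin_le.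
rewrite ltrBrDr => h; apply: le_lt_trans h.
by rewrite -(subrKA (y i)) ler_normD.
Qed.

(** Otherwise each piece has a polynomial outside P vanishing on it, and the product of these
    vanishes on S and the zero set of P but is outside the prime P. *)
Lemma ex_piece (L : seq (seq (A * sign_cond))) :
  (forall x, S x -> exists2 l, List.In l L & forall c, List.In c l -> sat_cond c x) ->
  exists2 l, List.In l L & forall p,
    (forall x, zero_set P x -> (forall c, List.In c l -> sat_cond c x) -> p.@[x] = 0) -> P p.
Proof.
move=> SL; have [_ P1 Ppr] := Pp; apply: contrapT => no.
have [f nPf fL] : exists2 f, ~ P f & forall l, List.In l L -> forall x, zero_set P x ->
    (forall c, List.In c l -> sat_cond c x) -> f.@[x] = 0.
  elim: L {SL} no => [|l L IH] no; first by exists 1.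
  have [|f nPf fL] := IH.
    by move=> [l' l'L l'P]; apply: no; exists l' => //; right.
  have [g nPg gl] : exists2 g, ~ P g & forall x, zero_set P x ->
      (forall c, List.In c l -> sat_cond c x) -> g.@[x] = 0.
    apply: contrapT => nog; apply: no; exists l; first by left.
    by move=> p pl; apply: contrapT => nPp; apply: nog; exists p.
  exists (g * f); first by case/Ppr.
  move=> l' [<-|l'L] x Vx xl; rewrite mevalM; first by rewrite gl ?mul0r.
  by rewrite (fL l') ?mulr0.
by apply/nPf/SP => x [/SL[l lL xl] Vx]; exact: fL xl.
Qed.

(** Choose a point of the piece where [f] and all condition polynomials outside P are nonzero. Their
    conditions are then strict inequalities there and persist nearby; the polynomials in P vanish on
    the whole zero set. *)
Lemma ex_generic_point (l : seq (A * sign_cond)) f : ~ P f ->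
  (forall p, (forall x, zero_set P x ->
    (forall c, List.In c l -> sat_cond c x) -> p.@[x] = 0) -> P p) ->
  exists x, [/\ zero_set P x, f.@[x] != 0 & exists2 r : R, 0 < r &
    forall y, near_pt r x y -> zero_set P y -> forall c, List.In c l -> sat_cond c y].
Proof.
move=> nPf lP; have [_ P1 Ppr] := Pp.
have [g nPg gl] : exists2 g, ~ P g & forall c, List.In c l -> P c.1 \/
    forall x, g.@[x] != 0 -> c.1.@[x] != 0.
  elim: l {lP} => [|c l [g nPg gl]]; first by exists 1.
  have [Pc|nPc] := pselect (P c.1).
    by exists g => // c' [<-|/gl//]; left.
  exists (c.1 * g); first by case/Ppr.
  move=> c' [<-|/gl[Pc'|gc']]; [right|by left|right] => x;
    rewrite mevalM mulf_eq0 negb_or => /andP[// _]; exact: gc'.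
have [x [Vx xl fgx]] : exists x, [/\ zero_set P x,
    forall c, List.In c l -> sat_cond c x & (f * g).@[x] != 0].
  apply: contrapT => no; have : ~ P (f * g) by case/Ppr.
  apply; apply: lP => x Vx xl; apply/eqP; apply: contrapT => /negP fgx.
  by apply: no; exists x.
move: fgx; rewrite mevalM mulf_eq0 negb_or => /andP[fx gx].
exists x; split=> //; elim: l {lP} gl xl => [|c l IH] gl xl; first by exists 1.
have [||r r0 rP] := IH.
- by move=> c' c'l; apply: gl; right.
- by move=> c' c'l; apply: xl; right.
have [s s0 sP] : exists2 s : R, 0 < s & forall y, near_pt s x y -> zero_set P y -> sat_cond c y.
  have xc := xl c (or_introl erefl); move: (xc).
  case: (gl c (or_introl erefl)) => [Pc|/(_ x gx) cx] => [_|].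
    exists 1 => // y _ Vy; move: xc; rewrite /sat_cond (Vx _ Pc) (Vy _ Pc).
    by case: c.2.
  have pos : 0 < c.1.@[x] -> exists2 s : R, 0 < s & forall y, near_pt s x y -> 0 < c.1.@[y].
    exact: meval_gt0_near.
  rewrite /sat_cond; case: c.2 => [/pos[s s0 sP]|cx0|/eqP]; last by rewrite (negPf cx).
    by exists s => // y /sP.
  have [|s s0 sP] := pos; first by rewrite lt_def cx.
  by exists s => // y /sP /ltW.
exists (Num.min r s); first by rewrite lt_min r0.
move=> y xy Vy c' [<-|c'l].
  by apply: sP Vy; apply: near_ptW xy; rewrite ge_min lexx orbT.
by apply: rP Vy _ c'l; apply: near_ptW xy; rewrite ge_min lexx.
Qed.

(** The manifold is the image of a small cube of R^T under the local section; reading off the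
    coordinates in T inverts it. *)
Lemma ex_manifold : contains_manifold (fun x => S x /\ zero_set P x) #|T|.
Proof.
have [L SL] := Sa.
have [|l lL lP] := @ex_piece L; first by move=> x /SL.
have [f nPf fsec] := local_section Pp Tmax.
have [x [Vx fx [r r0 rP]]] := ex_generic_point nPf lP.
have [s s0 [Psi [Psix PsiT PsiP Psic]]] := fsec x Vx fx.
have PsiV u : near_pt s x u -> zero_set P (Psi u).
  by move=> xu p Pp'; apply: PsiP => //; exact: resT.
have [t t0 tP] := Psic x (near_pt_refl x s0) r r0.
pose q := Num.min s t.
have q0 : 0 < q by rewrite lt_min s0.
have qs u : near_pt q x u -> near_pt s x u by apply: near_ptW; rewrite ge_min lexx.
have qr u : near_pt q x u -> near_pt r x (Psi u).
  move=> xu; rewrite -[x in near_pt _ x _]Psix; apply: tP; first exact: qs.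
  by apply: near_ptW xu; rewrite ge_min lexx orbT.
pose T_ (k : 'I_#|T|) : 'I_n := enum_val k.
(* The coordinates outside T are filled in from [x]. *)
pose emb (u : 'I_#|T| -> R) i := if [pick k | T_ k == i] is Some k then u k else x i.
have embT u k : emb u (T_ k) = u k.
  rewrite /emb; case: pickP => [l' /eqP/enum_val_inj->//|/(_ k)].
  by rewrite eqxx.
pose x' k := x (T_ k).
have emb_near u v e : 0 < e -> near_pt e u v -> near_pt e (emb u) (emb v).
  move=> e0 uv i; rewrite /emb; case: pickP => [k _|_]; first exact: uv.
  by rewrite subrr normr0.
have embx : emb x' = x.
  apply: funext => i; rewrite /emb; case: pickP => // k /eqP <- //.
have embq u : near_pt q x' u -> near_pt q x (emb u).
  by move=> xu; rewrite -embx; apply: emb_near.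
pose M y := exists2 u, near_pt q x' u & y = Psi (emb u).
have phiK u : (fun k => Psi (emb u) (T_ k)) = u.
  by apply: funext => k; rewrite PsiT ?embT //; exact: enum_valP.
exists M; split.
  move=> _ [u xu ->]; have xe := embq _ xu; split; last exact/PsiV/qs.
  by apply/SL; exists l => //; apply: rP; [exact: qr | exact/PsiV/qs].
split; first by exists (Psi (emb x')), x' => //; exact: near_pt_refl.
move=> y0 _; exists (fun=> True), (near_pt q x'), (fun y k => y (T_ k)), (fun u => Psi (emb u)).
split; first by split=> //; [move=> y _; exists 1 | exact: near_pt_open].
split; first split.
- by move=> _ [u xu ->] _; rewrite phiK.
- by move=> u xu; split=> //; exists u.
- by move=> _ [u xu ->] _; rewrite phiK.
- by move=> u _; exact: phiK.
split; first by move=> y _ e e0; exists e => // z _ yz k; exact: yz.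
move=> u xu e e0; have [h h0 hP] := Psic (emb u) (qs _ (embq _ xu)) e e0.
exists h => // v xv uv; apply: hP; first exact/qs/embq.
exact: emb_near.
Qed.

End Manifold.

(** * Comparison of the two dimensions *)

Lemma manifold_indep (R : realType) (n d : nat) (S : ('I_n -> R) -> Prop) :
  contains_manifold S d ->
  exists2 T : {set 'I_n}, (d <= #|T|)%N & indep (vanishing_ideal S) T.
Proof.
move=> [M [MS [[x Mx] /(_ x Mx)]]].
move=> [W [U [phi [psi [[Wo Wx Uo] [[phiU psiM psiK phiK] [_ psic]]]]]]].
have psi_inj u v : U u -> U v -> psi u = psi v -> u = v.
  by move=> Uu Uv uv; rewrite -(phiK u Uu) uv phiK.
have [T dT Ti] := chart_indep Uo psic psi_inj (phiU x Mx Wx).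
exists T => //; apply: indep_subideal Ti => p Sp _ [u Uu <-].
by apply/Sp/MS; case: (psiM u Uu).
Qed.

Theorem theorem2p2 (R : realType) (n : nat) (S : ('I_n -> R) -> Prop)
  (I : {mpoly R[n]} -> Prop) (k : nat) (Is : 'I_k -> {mpoly R[n]} -> Prop) :
  semialgebraic S ->
  is_ideal I ->
  prime_decomposition I Is ->
  (forall p, vanishing_ideal (fun x => S x /\ zero_set I x) p <-> I p) <->
  (forall t : 'I_k, exists d : int,
      dim_top_is (fun x => S x /\ zero_set (Is t) x) d /\ krull_dim_is (Is t) d).
Proof.
move=> Sa Ii [Isp IE irr]; split=> [SI t | dims p].
  have Pp := Isp t; have [Pi P1 Ppr] := Pp.
  have SP p : vanishing_ideal (fun x => S x /\ zero_set (Is t) x) p -> Is t p.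
    (* Irredundancy gives g in the other components but outside [Is t]. Then p g vanishes on S and
       the zero set of I: off the zero set of [Is t] some h in [Is t] is nonzero, and h g in I
       forces g to vanish. *)
    move=> Vp; have [g [gs ngt]] := irr t.
    have /IE /(_ t) /Ppr [] // : I (p * g).
    apply/SI => x [Sx Ix]; rewrite mevalM.
    have [xt|nxt] := pselect (zero_set (Is t) x); first by rewrite Vp ?mul0r.
    have [h [ht hx]] : exists h, Is t h /\ h.@[x] != 0.
      apply: contrapT => no; apply: nxt => h ht; apply/eqP; apply: contrapT => /negP hx.
      by apply: no; exists h.
    have /Ix /eqP : I (h * g).
      apply/IE => s; have [->|st] := eqVneq s t; first exact: idealMr.
      by have [[_ _ PM] _ _] := Isp s; apply: PM; exact: gs.
    by rewrite mevalM mulf_eq0 (negPf hx) => /eqP->; rewrite mulr0.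
  (* The size of a largest independent set is the common value of both dimensions. *)
  pose Q (T : {set 'I_n}) := `[< indep (Is t) T >].
  have Q0 : Q set0 by apply/asboolP; exact: indep0.
  case: (@arg_maxnP _ set0 Q (fun T : {set 'I_n} => #|T|) Q0) => T /asboolP Ti Tcard.
  have maxT U : indep (Is t) U -> (#|U| <= #|T|)%N by move=> /asboolP; exact: Tcard.
  have Tmax : max_indep (Is t) T.
    by split=> // j jT /maxT; rewrite cardsU1 jT add1n ltnn.
  exists #|T|%:Z; split; split.
  - move=> e /manifold_indep[U eU Ui]; rewrite lez_nat; apply: leq_trans eU (maxT _ _).
    by apply: indep_subideal Ui => q Pq x [_]; apply.
  - by right; exists #|T| => //; exact: ex_manifold.
  - by move=> e /prime_chain_indep[U <- Ui]; rewrite lez_nat maxT.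
  - by right; exists #|T| => //; exact: indep_prime_chain Ti _.
split=> [Vp|Ip x [_]]; last by apply.
apply/IE => t; have [d [[_ topd] [kub _]]] := dims t.
have Pp := Isp t; have [Pi P1 Ppr] := Pp; have [_ PD PM] := Pi.
have chain U e : indep (Is t) U -> (e <= #|U|)%N -> e%:Z <= d.
  by move=> Ui eU; apply: kub; exact: indep_prime_chain eU.
(* The value -1 is excluded because a prime alone is a chain of length 0. *)
case: topd => [dE|[e /manifold_indep[T eT Ti] dE]].
  by have := chain _ 0%N (indep0 Pi P1) isT; rewrite dE.
have Ti' : indep (Is t) T.
  by apply: indep_subideal Ti => q Pq x [_]; apply.
(* T already has at least d elements, and a larger independent set would give a chain longer than
   d. *)
have Tmax : max_indep (Is t) T.
  split=> // j jT ji; have := chain _ #|T|.+1 ji.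
  by rewrite cardsU1 jT add1n leqnn dE lez_nat => /(_ isT); rewrite ltnNge eT.
apply: contrapT => nPp.
have [a [g [aT a0 Pa]]] := ex_multiple_in_T Pp Tmax nPp.
apply/a0/Ti => // x [Sx Vx].
have := Vx _ Pa; rewrite mevalB mevalM (Vp x) ?mulr0 ?subr0 //.
by split=> // q /IE /(_ t); exact: Vx.
Qed.
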